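(* Let $c\in\mathbb{R}$ be a constant, $p(n)=\frac{\log n+c+o(1)}{n}$ and $0\le q(n)\le 1$. Then, as $n\to\infty$, $$\mathrm{P}\bigl(G_{n,p(n)}^{q(n)}\in\mathcal{D}^n\bigr)\ \ge\ e^{-2(1-q(n))e^{-c}}\Bigl[1+2(1-q(n))e^{-c}+(1-q(n))^2e^{-2c}\Bigr]+o(1),$$ that is, the limit inferior as $n\to\infty$ of the left-hand side minus the main term on the right-hand side is at least $0$.
   Context: A digraph $G=(V,E)$ on $n$ vertices has $V=\{1,\dots,n\}$ and $E\subseteq V\times V$ (self-loops $(i,i)$ allowed). Its structured matrix $\bar A\in\{0,*\}^{n\times n}$ has $\bar A_{ij}=*$ if $(i,j)\in E$ and $\bar A_{ij}=0$ otherwise. A realization of $\bar A$ is a real matrix obtained by assigning real numbers to the $*$ entries and keeping the zero entries. $G$ (equivalently $\bar A$) is structurally diagonalizable if for almost all (with respect to Lebesgue measure on $\mathbb{R}^{|E|}$) real assignments to the $*$ entries, the resulting matrix is diagonalizable (over $\mathbb{C}$). $\mathcal{D}^n$ is the set of structurally diagonalizable digraphs with $n$ vertices. In the random digraph model $\mathcal{G}(n,p,q)$ on $n$ labeled vertices, each ordered pair $(u,v)$ with $u\ne v$ is an edge with probability $p$, each self-loop $(u,u)$ is present with probability $q$, all independently. $G_{n,p(n)}^{q(n)}$ denotes a random digraph sampled from $\mathcal{G}(n,p(n),q(n))$. *)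

(* Defs.v *)
From HB Require Import structures.
From mathcomp Require Import all_boot all_order all_algebra.
From mathcomp Require Import complex.
From mathcomp Require Import all_classical all_reals all_analysis.

Set Implicit Arguments.
Unset Strict Implicit.
Unset Printing Implicit Defensive.

Import Order.TTheory GRing.Theory Num.Theory numFieldNormedType.Exports.

Local Open Scope classical_set_scope.
Local Open Scope ring_scope.

Section LebesgueTuple.
Context {R : realType}.
Local Notation mR := (measurableTypeR R).
Local Open Scope ereal_scope.

Definition tuple_cons n (x : mR * n.-tuple mR) : n.+1.-tuple mR :=
  [tuple of x.1 :: x.2].

Definition tuple_uncons n (t : n.+1.-tuple mR) : mR * n.-tuple mR :=
  (thead t, [tuple of behead t]).

Lemma tuple_unconsK n : cancel (@tuple_uncons n) (@tuple_cons n).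
Proof. by move=> t; rewrite [RHS]tuple_eta. Qed.

Lemma tuple_consK n : cancel (@tuple_cons n) (@tuple_uncons n).
Proof.
move=> [x t]; rewrite /tuple_uncons /tuple_cons /=; congr pair.
exact/val_inj.
Qed.

Lemma measurable_tuple_cons n : measurable_fun setT (@tuple_cons n).
Proof. exact: measurable_cons. Qed.

Lemma measurable_tuple_uncons n : measurable_fun setT (@tuple_uncons n).
Proof.
apply/measurable_fun_pairP; split.
- exact: measurable_tnth.
- exact: measurable_behead.
Qed.

Section Step.
Variables (n : nat) (mu : {sigma_finite_measure set (n.-tuple mR) -> \bar R}).

Definition lebesgue_cons (A : set (n.+1.-tuple mR)) : \bar R :=
  pushforward (lebesgue_measure \x mu) (@tuple_cons n) A.

Let mpreimage (A : set (n.+1.-tuple mR)) :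
  measurable A -> measurable (@tuple_cons n @^-1` A).
Proof.
by move=> mA; rewrite -[X in measurable X]setTI; exact: measurable_tuple_cons.
Qed.

Let lebesgue_cons0 : lebesgue_cons set0 = 0.
Proof. by rewrite /lebesgue_cons /pushforward preimage_set0 measure0. Qed.

Let lebesgue_cons_ge0 A : 0 <= lebesgue_cons A.
Proof. by rewrite /lebesgue_cons /pushforward; exact: measure_ge0. Qed.

Let lebesgue_cons_sigma_additive : semi_sigma_additive lebesgue_cons.
Proof.
move=> F mF tF mUF; rewrite /lebesgue_cons /pushforward preimage_bigcup.
apply: measure_semi_sigma_additive.
- by move=> i; exact: mpreimage.
- apply/trivIsetP => /= i j _ _ ij; rewrite -preimage_setI.
  by move/trivIsetP : tF => /(_ _ _ _ _ ij) ->//; rewrite preimage_set0.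
- by rewrite -preimage_bigcup; exact: mpreimage.
Qed.

HB.instance Definition _ := isMeasure.Build _ _ _ lebesgue_cons
  lebesgue_cons0 lebesgue_cons_ge0 lebesgue_cons_sigma_additive.

Let lebesgue_cons_sigma_finite : sigma_finite setT lebesgue_cons.
Proof.
have /sigma_finiteP[F [TF ndF Foo]] := sigma_finiteT (@lebesgue_measure R).
have /sigma_finiteP[G [TG ndG Goo]] := sigma_finiteT mu.
exists (fun k => @tuple_uncons n @^-1` (F k `*` G k)).
  rewrite -preimage_bigcup (_ : \bigcup_k _ = setT) ?preimage_setT//.
  rewrite -setXTT TF TG predeqE => -[x y]; split.
    by move=> [k _ []/= ? ?]; split; exists k.
  move=> [/= [k _ Fkx] [l _ Gly]]; exists (maxn k l) => //; split.
  - by move: x Fkx; exact/subsetPset/ndF/leq_maxl.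
  - by move: y Gly; exact/subsetPset/ndG/leq_maxr.
move=> k; have [? ?] := Foo k; have [? ?] := Goo k.
split.
  rewrite -[X in measurable X]setTI.
  by apply: measurable_tuple_uncons => //; exact: measurableX.
rewrite /lebesgue_cons /pushforward -comp_preimage.
rewrite (_ : _ \o _ = id) ?preimage_id; last exact/funext/tuple_consK.
by rewrite product_measure1E// lte_mul_pinfty// ge0_fin_numE.
Qed.

HB.instance Definition _ := Measure_isSigmaFinite.Build _ _ _ lebesgue_cons
  lebesgue_cons_sigma_finite.

End Step.

(* Lebesgue measure on R^n, as the n-fold product of the Lebesgue measure on
   the line; R^0 is a single point, of mass 1. *)
Fixpoint lebesgue_tuple (n : nat) :
    {sigma_finite_measure set (n.-tuple mR) -> \bar R} :=
  match n with
  | 0%N => dirac ([tuple] : 0.-tuple mR)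
  | m.+1 => lebesgue_cons (lebesgue_tuple m)
  end.

Lemma lebesgue_tuple_box n (A : 'I_n -> set mR) : (forall i, measurable (A i)) ->
  lebesgue_tuple n [set t | forall i, A i (tnth t i)] =
  \prod_(i < n) lebesgue_measure (A i).
Proof.
elim: n A => [|n IH] A mA.
  rewrite big_ord0 /= diracE mem_set//= => -[]//.
rewrite big_ord_recl -IH//= /lebesgue_cons /pushforward.
rewrite -product_measure1E//; last first.
  rewrite (_ : mkset _ = \bigcap_(i in [set: 'I_n])
      (fun t : n.-tuple mR => tnth t i) @^-1` A (lift ord0 i)); last first.
    by apply/seteqP; split => [t h i _|t h i]; [exact: h|exact: (h i Logic.I)].
  apply: fin_bigcap_measurable => //= i _.
  rewrite -[X in measurable X]setTI; exact: measurable_tnth.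
congr (_ _); apply/seteqP; split => -[x t] /=.
- move=> h; split; first exact: (h ord0).
  by move=> i; have := h (lift ord0 i); rewrite tnthS.
- by case=> h0 h i; case: (unliftP ord0 i) => [j|] ->; rewrite ?tnthS//; exact: h.
Qed.

End LebesgueTuple.
Arguments lebesgue_tuple R n : clear implicits.

Section Digraphs.
Variable R : realType.

(* The edge set, self-loops allowed; the vertex set is 'I_n. *)
Definition digraph (n : nat) := {set 'I_n * 'I_n}.

(* The realization of the structured matrix of G in which the i-th edge of
   [enum G] gets the value [tnth t i]. *)
Definition realization n (G : digraph n) (t : #|G|.-tuple (measurableTypeR R)) : 'M[R]_n :=
  \matrix_(i, j)
    if (i, j) \in G then nth 0 t (index (i, j) (enum G)) else 0.

Definition diagonalizable_over_C n (A : 'M[R]_n) : Prop :=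
  diagonalizable (map_mx (real_complex R) A).

Definition structurally_diagonalizable n (G : digraph n) : Prop :=
  {ae lebesgue_tuple R #|G|, forall t, diagonalizable_over_C (realization t)}.

Definition structurally_diagonalizable_digraphs n : set (digraph n) :=
  [set G | structurally_diagonalizable G].

Definition edge_prob n (p q : R) (e : 'I_n * 'I_n) : R :=
  if e.1 == e.2 then q else p.

(* The probability that a sample of G(n, p, q) equals G: the entries of the
   product are the independent choices made for the ordered pairs. This is a
   probability distribution as soon as p and q both lie in [0, 1]. *)
Definition digraph_mass n (p q : R) (G : digraph n) : R :=
  \prod_(e : 'I_n * 'I_n)
    (if e \in G then edge_prob p q e else 1 - edge_prob p q e).

Definition digraph_prob n (p q : R) (C : set (digraph n)) : R :=
  \sum_(G : digraph n | G \in C) digraph_mass p q G.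

End Digraphs.
Arguments structurally_diagonalizable_digraphs R n : clear implicits.

(* Main.v *)
Require Import Defs.
From HB Require Import structures.
From mathcomp Require Import all_boot all_order all_algebra all_fingroup.
From mathcomp Require Import all_field complex.
From mathcomp Require Import all_classical all_reals all_analysis.
From mathcomp Require Import measurable_realfun ring lra zify.

Set Implicit Arguments.
Unset Strict Implicit.
Unset Printing Implicit Defensive.

Import Order.TTheory GRing.Theory Num.Theory numFieldNormedType.Exports.

Local Open Scope ring_scope.

(** Let lam = (1 - q) * exp (- c).  The rows of the random matrix are
    independent, each of them is zero with probability
    a = (1 - q) * (1 - p) ^ (n - 1), and n * a - lam tends to 0; the same holds
    for the columns.

    If the rows in a set Z are zero and the rest of the graph has a cycle cover
    (a permutation of the complement of Z moving along edges), then the graph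
    is structurally diagonalizable: the number of nonzero eigenvalues of a
    generic realization equals its rank, and these eigenvalues are distinct.
    The same holds for columns.  Only the sets Z with at most two elements
    are used.  The cycle cover outside Z depends on cells that do not meet the
    rows in Z, so the event attached to Z has probability exactly a ^ |Z|
    times the probability of a cycle cover on the complement of Z, and these
    events are disjoint for different Z.  Summing over |Z| <= 2 for rows and
    over 1 <= |Z| <= 2 for columns produces the factor
    1 + 2 * lam + 2 * (lam ^ 2 / 2); a row event and a column event both occur
    only in the presence of an isolated vertex, which has probability O(1 / n).
    It remains to show that a cycle cover exists on a set S missing at most two
    vertices with probability at least exp (- 2 * lam) - o(1).

    Genericity ([structurally_diagonalizable_cover]).  Put nonzero
    numbers on the diagonal cells of Z.  The permutation of the cover, extended
    by the identity, gives a realization of the modified matrix which is a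
    weighted permutation matrix with distinct nonzero eigenvalues
    ([separable_char_poly_weighted_perm]).  Hence the resultant of 'X times the
    characteristic polynomial and its derivative is a nonzero polynomial in the
    entries, and it vanishes only on a null set ([ae_iter_eval_neq0]).  Where it
    does not vanish, the unmodified matrix is diagonalizable
    ([diagonalizable_shift]).

    Cycle covers ([cycle_cover_prob]).  That no row and no column of S is zero
    is an intersection of increasing events, so Harris' inequality bounds its
    probability below by the product of their probabilities, which is at least
    exp (- 2 * lam) - o(1).  If no line is zero and there is still no cover, a minimal
    violation of Hall's condition is a set A of lines with 2 <= |A| and
    2 * |A| <= |S| + 1 that meets exactly |A| - 1 lines of the other side, each
    of them at least twice ([cycle_coverN_sparse_pair]).  The expected number
    of such configurations tends to 0 ([hall_sum_le]). *)

(** * Diagonalizability after a diagonal shift *)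

Lemma horner_mx_mulr_eq (F : fieldType) n (A B : 'M[F]_n.+1) (f : {poly F}) :
  B * A = A * A -> horner_mx B f * A = horner_mx A f * A.
Proof.
move=> BA; elim/poly_ind: f => [|f a IHf]; first by rewrite !rmorph0 !mul0r.
rewrite !(rmorphD, rmorphM) /= !horner_mx_X !horner_mx_C !mulrDl; congr (_ + _).
by rewrite -!mulrA BA !mulrA IHf -!mulrA.
Qed.

Lemma horner_mx_mull_eq (F : fieldType) n (A B : 'M[F]_n.+1) (f : {poly F}) :
  A * B = A * A -> A * horner_mx B f = A * horner_mx A f.
Proof.
move=> AB; elim/poly_ind: f => [|f a IHf]; first by rewrite !rmorph0 !mulr0.
have cX C : C * horner_mx C f = horner_mx C f * C by apply/comm_mx_horner.
rewrite !(rmorphD, rmorphM) /= !horner_mx_X !horner_mx_C !mulrDr; congr (_ + _).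
by rewrite -!cX !mulrA AB -!mulrA IHf.
Qed.

(** The hypothesis on [D] makes (A + D) A = A A (or its mirror image), so every
    polynomial in [A + D] acts on [A] as the same polynomial in [A].  By
    Cayley-Hamilton for [A + D], the separable polynomial of the hypothesis
    annihilates [A]. *)
Lemma diagonalizable_shift (F : closedFieldType) n (A D : 'M[F]_n) :
  D *m A = 0 \/ A *m D = 0 ->
  separable_poly ('X * char_poly (A + D)) -> diagonalizable A.
Proof.
case: n => [|n] in A D * => AD sep.
  by rewrite [A]flatmx0; apply: diagonalizable0.
have annA : horner_mx A ('X * char_poly (A + D)) = 0.
  have CH : horner_mx (A + D) (char_poly (A + D)) = 0 by apply: Cayley_Hamilton.
  case: AD => AD.
  - rewrite mulrC rmorphM /= horner_mx_X -(@horner_mx_mulr_eq _ _ A (A + D)).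
      by rewrite CH mul0r.
    by rewrite mulrDl -[D * A]/(D *m A) AD addr0.
  - rewrite rmorphM /= horner_mx_X -(@horner_mx_mull_eq _ _ A (A + D)).
      by rewrite CH mulr0.
    by rewrite mulrDr -[A * D]/(A *m D) AD addr0.
have nz : lead_coef ('X * char_poly (A + D)) != 0.
  by rewrite lead_coef_eq0 separable_poly_neq0.
have [r Er] := closed_field_poly_normal ('X * char_poly (A + D)).
apply/diagonalizableP; exists r.
  by rewrite -separable_prod_XsubC -(eqp_separable (eqp_scale _ nz)) -Er.
by rewrite -(dvdpZr _ _ nz) -Er mxminpoly_min.
Qed.

(** Nonvanishing of the leading coefficients keeps the degrees, hence the size of
    the Sylvester matrix. *)
Lemma resultant_rmorphism (aR rR : nzRingType) (f : {rmorphism aR -> rR})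
    (p q : {poly aR}) :
    f (lead_coef p) != 0 -> f (lead_coef q) != 0 ->
  f (resultant p q) = resultant (map_poly f p) (map_poly f q).
Proof.
move=> nz_fp nz_fq; rewrite /resultant /Sylvester_mx !size_map_poly_id0 //.
rewrite -det_map_mx /= map_col_mx; congr (\det (col_mx _ _));
  by apply: map_lin1_mx => v; rewrite map_poly_rV rmorphM /= map_rVpoly.
Qed.

(** * Weighted permutation matrices have a separable characteristic polynomial *)

(** The derivative of g(X^N) is g'(X^N) times N X^(N-1): a Bezout relation for [g]
    and its derivative, evaluated at X^N, takes care of the first factor, and
    g(0) != 0 of the second. *)
Lemma separable_comp_Xn (F : fieldType) (g : {poly F}) N :
  N%:R != 0 :> F -> separable_poly g -> ~~ root g 0 ->
  separable_poly (g \Po 'X^N).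
Proof.
have sepE (p : {poly F}) : separable_poly p = coprimep p p^`() by rewrite unlock.
move=> N0; rewrite !sepE => /Bezout_eq1_coprimepP[[u v] /= Euv] g0.
have N_gt0 : (0 < N)%N by case: N N0 => //; rewrite eqxx.
rewrite deriv_comp derivXn coprimepMr; apply/andP; split.
  apply/Bezout_eq1_coprimepP; exists (u \Po 'X^N, v \Po 'X^N) => /=.
  by rewrite -!rmorphM -rmorphD /= Euv rmorph1.
rewrite -mulr_natl -polyC_natr mul_polyC coprimepZr // coprimep_expr //.
rewrite coprimepX.
by rewrite /root horner_comp hornerXn expr0n eqn0Ngt N_gt0.
Qed.

Section WeightedPermutation.
Variables (F : fieldType) (n : nat) (s : 'S_n.+1) (d : 'I_n.+1 -> F).

Definition weighted_perm_mx : 'M[F]_n.+1 := \matrix_(i, j) (d i *+ (j == s i)).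

Local Notation W := weighted_perm_mx.
Local Notation N := #[s]%g.
Hypothesis ds : forall i, d (s i) = d i.
Hypothesis d0 : forall i, d i != 0.
Hypothesis dinj : forall i j, d i ^+ N = d j ^+ N -> j \in porbit s i.
Hypothesis N0 : N%:R != 0 :> F.

Lemma mul_weighted_perm_mx m (A : 'M[F]_(m, n.+1)) k i :
  (A *m W) k (s i) = A k i * d i.
Proof.
rewrite mxE (bigD1 i) //= mxE eqxx mulr1n big1 ?addr0 // => j ji.
by rewrite mxE (inj_eq perm_inj) eq_sym (negPf ji) mulr0n mulr0.
Qed.

Lemma exp_weighted_perm_mx k :
  W ^+ k = \matrix_(i, j) (d i ^+ k *+ (j == (s ^+ k)%g i)).
Proof.
elim: k => [|k IHk]; first by apply/matrixP=> i j; rewrite !mxE expg0 perm1 eq_sym.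
apply/matrixP=> i j; rewrite exprSr -[W ^+ k * W]/(W ^+ k *m W) IHk.
rewrite -[j](permKV s); move: (s^-1%g j) => {}j.
rewrite mul_weighted_perm_mx.
rewrite !mxE expgSr permM (inj_eq perm_inj).
case: eqP => [->|]; last by rewrite mul0r.
rewrite !mulr1n exprSr; congr (_ * _).
elim: k {IHk} => [|k IHk]; first by rewrite expg0 perm1.
by rewrite expgSr permM ds.
Qed.

Lemma exp_weighted_perm_mx_order : W ^+ N = diag_mx (\row_i (d i ^+ N)).
Proof.
by rewrite exp_weighted_perm_mx expg_order; apply/matrixP => i j; rewrite !mxE perm1 eq_sym.
Qed.

(** The power of the matrix by the order of [s] is diagonal and separates the
    cycles of [s], so an eigenvector lives on a single cycle; on that cycle it
    is determined by one coordinate.  Two eigenvectors with the same eigenvalue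
    are therefore proportional. *)
Lemma eigenvector_weighted_perm_mx (u v : 'rV[F]_n.+1) a i j : a != 0 ->
  u *m W = a *: u -> v *m W = a *: v -> u 0 j * v 0 i = v 0 j * u 0 i.
Proof.
move=> a0 uW vW.
have suppE (w : 'rV[F]_n.+1) k : w *m W = a *: w -> w 0 k != 0 -> d k ^+ N = a ^+ N.
  move=> wW wk; have wWN m : w *m (W ^+ m) = a ^+ m *: w.
    elim: m => [|m IHm]; first by rewrite !expr0 scale1r mulmx1.
    by rewrite exprSr -[W ^+ m * W]/(W ^+ m *m W) mulmxA IHm -scalemxAl wW scalerA exprSr.
  move: (wWN N) => /matrixP/(_ 0 k); rewrite exp_weighted_perm_mx_order mul_mx_diag !mxE.
  by rewrite mulrC => /mulIf; apply.
have step (w : 'rV[F]_n.+1) k : w *m W = a *: w -> a * w 0 (s k) = w 0 k * d k.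
  by move=> wW; rewrite -mul_weighted_perm_mx wW mxE.
have [ui|ui] := eqVneq (u 0 i) 0.
  have [vi|vi] := eqVneq (v 0 i) 0; first by rewrite ui vi !mulr0.
  have [uj|uj] := eqVneq (u 0 j) 0; first by rewrite uj ui mul0r mulr0.
  have : i \in porbit s j by apply: dinj; rewrite (suppE u j) // (suppE v i).
  case/porbitP => k Ek; have : u 0 i != 0; last by rewrite ui eqxx.
  rewrite Ek; elim: k {Ek} => [|k IHk]; first by rewrite expg0 perm1.
  rewrite expgSr permM; apply/eqP => uk; have := step u ((s ^+ k)%g j) uW.
  by rewrite uk mulr0 => /esym/eqP; rewrite mulf_eq0 (negPf IHk) (negPf (d0 _)).
have [/porbitP[k ->]|jNi] := boolP (j \in porbit s i).
  elim: k => [|k IHk]; first by rewrite expg0 perm1 mulrC.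
  rewrite expgSr permM; apply: (mulfI a0).
  rewrite !mulrA (step u) // (step v) // [_ * d _]mulrC -mulrA IHk.
  by rewrite !mulrA [d _ * _]mulrC.
have out (w : 'rV[F]_n.+1) : w *m W = a *: w -> w 0 j = 0.
  move=> wW; apply/eqP; apply: contraNT jNi => wj; apply: dinj.
  by rewrite (suppE u i) // (suppE w j).
by rewrite (out u) // (out v) // !mul0r.
Qed.

End WeightedPermutation.

(** The matrix is annihilated by a separable polynomial in X^#[s], so it is
    diagonalizable; its eigenspaces are lines by the previous lemma, so its
    eigenvalues are pairwise distinct. *)
Lemma separable_char_poly_weighted_perm (F : closedFieldType) n (s : 'S_n.+1)
    (d : 'I_n.+1 -> F) :
  #[s]%g%:R != 0 :> F ->
  (forall i, d (s i) = d i) -> (forall i, d i != 0) ->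
  (forall i j, d i ^+ #[s]%g = d j ^+ #[s]%g -> j \in porbit s i) ->
  separable_poly ('X * char_poly (weighted_perm_mx s d)).
Proof.
move=> N0 ds d0 dinj; set W := weighted_perm_mx s d.
pose e := \row_i (d i ^+ #[s]%g).
pose g : {poly F} := \prod_(r <- undup [seq e 0 i | i <- enum 'I_n.+1]) ('X - r%:P).
have sg : separable_poly g by rewrite separable_prod_XsubC undup_uniq.
have g0 : ~~ root g 0.
  rewrite root_prod_XsubC mem_undup; apply/negP => /mapP[i _] /esym /eqP.
  by rewrite mxE expf_eq0 (negPf (d0 i)) andbF.
have sf := separable_comp_Xn N0 sg g0.
have Wf : horner_mx W (g \Po 'X^#[s]%g) = 0.
  have gD : horner_mx (diag_mx e) g = 0 by rewrite /g -mxminpoly_diag mx_root_minpoly.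
  rewrite -[RHS]gD -exp_weighted_perm_mx_order // !rmorph_prod /=.
  apply: eq_bigr => r _.
  rewrite !rmorphB /= comp_polyX comp_polyC !horner_mx_C !horner_mx_X.
  by rewrite rmorphXn /= horner_mx_X.
have : diagonalizable W.
  have [r Er] := closed_field_poly_normal (g \Po 'X^#[s]%g).
  have nz : lead_coef (g \Po 'X^#[s]%g) != 0.
    by rewrite lead_coef_eq0 separable_poly_neq0.
  apply/diagonalizableP; exists r.
    by rewrite -separable_prod_XsubC -(eqp_separable (eqp_scale _ nz)) -Er.
  by rewrite -(dvdpZr _ _ nz) -Er mxminpoly_min.
case=> P Pu /diagonalizable_forPex[D /(simmxP Pu) PW].
have rowPW i : row i P *m W = D 0 i *: row i P.
  by rewrite -row_mul PW row_mul row_diag_mx -scalemxAl -rowE.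
have rowP0 i : row i P != 0.
  apply: contraTneq Pu => /(congr1 (mulmx^~ (invmx P))) Pi; apply/negP => Pu.
  move: Pi; rewrite -row_mul mulmxV // mul0mx => /matrixP/(_ 0 i)/eqP.
  by rewrite !mxE eqxx oner_eq0.
have D0 i : D 0 i != 0.
  apply: contraNneq (rowP0 i) => Di; apply/eqP/rowP => j.
  have /matrixP/(_ 0 (s j))/eqP := rowPW i.
  by rewrite mul_weighted_perm_mx Di scale0r !mxE mulf_eq0 (negPf (d0 j)) orbF => /eqP.
have Dinj : injective (D 0).
  move=> i j Dij; apply/eqP; apply: contraT => ij.
  have /rV0Pn[k Pk] := rowP0 i.
  have rel : (row j P) 0 k *: row i P = (row i P) 0 k *: row j P.
    apply/rowP => l; rewrite [LHS]mxE [RHS]mxE mulrC [RHS]mulrC.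
    have prop := @eigenvector_weighted_perm_mx F n s d ds d0 dinj
      (row i P) (row j P) (D 0 i) k l (D0 i) (rowPW i).
    rewrite prop //.
    by rewrite -[weighted_perm_mx s d]/W rowPW Dij.
  move: rel => /(congr1 (mulmx^~ (invmx P))); rewrite -!scalemxAl -!row_mul mulmxV //.
  move=> /matrixP/(_ 0 j); rewrite !mxE eqxx (negPf ij) mulr0 mulr1 => /esym/eqP.
  by move: Pk; rewrite mxE => /negPf->.
have -> : char_poly W = \prod_i ('X - (D 0 i)%:P).
  have -> : char_poly W = char_poly (diag_mx D).
    apply: (mulfI (_ : \det (map_mx polyC P) != 0)).
      by rewrite det_map_mx polyC_eq0 -unitfE -unitmxE.
    rewrite -det_mulmx [RHS]mulrC -det_mulmx /char_poly_mx mulmxBr mulmxBl.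
    by rewrite -!map_mxM PW scalar_mxC.
  rewrite char_poly_trig ?diag_mx_is_trig //.
  by apply: eq_bigr => i _; rewrite mxE eqxx.
have -> : 'X * \prod_i ('X - (D 0 i)%:P) =
    \prod_(z <- 0 :: [seq D 0 i | i <- enum 'I_n.+1]) ('X - z%:P).
  by rewrite big_cons big_map subr0 big_enum.
rewrite separable_prod_XsubC /= map_inj_uniq // enum_uniq andbT.
by apply/negP => /mapP[i _] /esym/eqP; rewrite (negPf (D0 i)).
Qed.

(** * The zero set of a nonzero polynomial is a null set *)

(** Polynomials in [n] variables as iterated univariate polynomials.  The outermost
    variable corresponds to the head of the tuple of values, matching the
    recursive construction of the Lebesgue measure on tuples. *)
Fixpoint iter_poly (R : idomainType) (n : nat) : idomainType :=
  if n is m.+1 then ({poly iter_poly R m} : idomainType) else R.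

Fixpoint iter_polyC (R : idomainType) n : {rmorphism R -> iter_poly R n} :=
  match n return {rmorphism R -> iter_poly R n} with
  | 0 => (idfun : {rmorphism R -> R})
  | m.+1 => (@polyC (iter_poly R m) \o iter_polyC R m
              : {rmorphism R -> {poly iter_poly R m}})
  end.

Fixpoint iter_eval (R : idomainType) n (s : seq R) : {rmorphism iter_poly R n -> R} :=
  match n return {rmorphism iter_poly R n -> R} with
  | 0 => (idfun : {rmorphism R -> R})
  | m.+1 => (@iter_eval R m (behead s)
               \o horner_eval (iter_polyC R m (head 0 s))
              : {rmorphism {poly iter_poly R m} -> R})
  end.

Fixpoint iter_polyX (R : idomainType) n (i : nat) : iter_poly R n :=
  match n return iter_poly R n with
  | 0 => 0 : R
  | m.+1 => if i is j.+1 then (iter_polyX R m j)%:P else 'X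
  end.

Lemma iter_evalC (R : idomainType) n s (x : R) : iter_eval n s (iter_polyC R n x) = x.
Proof. by elim: n s => //= n IHn s; rewrite horner_evalE hornerC. Qed.

Lemma iter_evalX (R : idomainType) n (s : seq R) i :
  (i < n)%N -> iter_eval n s (iter_polyX R n i) = s`_i.
Proof.
elim: n s i => // n IHn s [|i] /= ilt; rewrite horner_evalE.
  by rewrite hornerX iter_evalC nth0.
by rewrite hornerC IHn // nth_behead.
Qed.

Lemma measurable_iter_eval (R : realType) n (P : iter_poly R n) :
  measurable_fun setT (fun t : n.-tuple (measurableTypeR R) =>
    iter_eval n t P : measurableTypeR R).
Proof.
elim: n P => [|n IHn] P /=; first exact: measurable_cst.
rewrite (_ : (fun _ => _) = fun t : n.+1.-tuple (measurableTypeR R) =>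
   \sum_(i < size P) iter_eval n (behead t) P`_i * (tnth t ord0) ^+ i); last first.
  apply/funext => t; rewrite horner_evalE horner_coef rmorph_sum /=.
  apply: eq_bigr => i _; rewrite rmorphM rmorphXn iter_evalC /= -nth0.
  by rewrite (tnth_nth 0).
apply: measurable_sum => i; apply: measurable_funM.
  have := measurableT_comp (IHn P`_i) (@measurable_behead _ (measurableTypeR R) n); exact.
by apply: measurable_funX; exact: measurable_tnth.
Qed.

Section PolynomialZeros.
Local Open Scope classical_set_scope.

(** Induction on the number of variables, by Fubini: freezing the head of the tuple
    at x turns [P] into a polynomial in one variable less, which is nonzero
    except for the finitely many x that are roots of [P]. *)
Lemma ae_iter_eval_neq0 (R : realType) n (P : iter_poly R n) : P != 0 ->
  {ae lebesgue_tuple R n, forall t : n.-tuple (measurableTypeR R), iter_eval n t P != 0}.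
Proof.
move=> P0; pose Z := [set t : n.-tuple (measurableTypeR R) | iter_eval n t P = 0].
have mZ m (Q : iter_poly R m) :
    measurable [set t : m.-tuple (measurableTypeR R) | iter_eval m t Q = 0].
  have -> : [set t : m.-tuple (measurableTypeR R) | iter_eval m t Q = 0] =
     (fun t : m.-tuple (measurableTypeR R) => iter_eval m t Q : measurableTypeR R) @^-1` [set 0].
    by apply/seteqP; split.
  rewrite -[X in measurable X]setTI; apply: measurable_iter_eval => //.
exists Z; split; [exact: mZ| |by move=> t /= /negP; rewrite negbK => /eqP].
rewrite /Z {Z}; elim: n P P0 => [|n IHn] P P0.
  by rewrite /= diracE memNset //=; apply/eqP.
rewrite /= /lebesgue_cons /pushforward /product_measure1.
set B := @tuple_cons R n @^-1` _.
have mB : measurable B.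
  by rewrite -[X in measurable X]setTI; apply: measurable_tuple_cons => //; exact: mZ.
rewrite (@ae_eq_integral _ _ _ _ _ (cst 0%E)) //.
- by rewrite integral_cst // mul0e.
- exact: measurable_fun_xsection.
- pose N := [set x : measurableTypeR R | root P (iter_polyC R n x)].
  have fN : finite_set N.
    apply: contrapT => infN.
    have [B' B'N sB'] := infinite_set_fset (size P) infN.
    pose rs := map (iter_polyC R n) (finmap.enum_fset B').
    have : (size rs < size P)%N.
      apply: (@max_poly_roots (iter_poly R n)) => //.
        by apply/allP => y /mapP[x xB ->]; exact: B'N.
      rewrite map_inj_uniq ?finmap.fset_uniq //.
      by move=> x y /(congr1 (iter_eval n [::])); rewrite !iter_evalC.
    by rewrite size_map ltnNge sB'.
  exists N; split.
  + by apply: countable_measurable (finite_set_countable fN) => x; exact: measurable_set1.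
  + exact: countable_lebesgue_measure0 (finite_set_countable fN).
  + move=> x /= xN; rewrite /N /=; apply/negPn/negP => nroot; apply: xN => _.
    rewrite /= -[RHS](IHn (P.[iter_polyC R n x])); last exact: nroot.
    congr (lebesgue_tuple R n _); apply/seteqP; split => t; rewrite /xsection /B /= ?inE //.
Qed.

End PolynomialZeros.

(** * Generic diagonalizability from a cycle cover *)

(** The weight of a vertex is the rank of its cycle, shifted by one to be positive:
    real weights which are constant on cycles and differ, with all their
    powers, between cycles. *)
Lemma separable_char_poly_labelled_perm (R : realType) n (s : 'S_n.+1) :
  separable_poly ('X * char_poly (weighted_perm_mx s
     (fun i => (enum_rank (porbit s i)).+1%:R : R))).
Proof.
rewrite -(separable_map (real_complex R)) rmorphM /= map_polyX map_char_poly.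
set d := fun i => (enum_rank (porbit s i)).+1%:R : R[i]%C.
have -> : map_mx (real_complex R) (weighted_perm_mx s
     (fun i => (enum_rank (porbit s i)).+1%:R)) = weighted_perm_mx s d.
  by apply/matrixP => i j; rewrite !mxE rmorphMn rmorph_nat.
have porbitS i : porbit s (s i) = porbit s i.
  by apply/eqP; rewrite eq_porbit_mem; have := mem_porbit s 1 i; rewrite expg1.
apply: separable_char_poly_weighted_perm.
- by rewrite pnatr_eq0 -lt0n order_gt0.
- by move=> i; rewrite /d porbitS.
- by move=> i; rewrite /d pnatr_eq0.
move=> i j /eqP; rewrite /d -!natrX eqr_nat eqn_exp2r ?order_gt0 // eqSS.
by move=> /eqP/val_inj/enum_rank_inj ->; rewrite porbit_id.
Qed.

(** The matrix [D] carries the cycle weights on the diagonal cells of [Z], and [s]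
    fixes [Z], so giving its weight to each edge (i, s i) turns the realization
    plus [D] into a weighted permutation matrix.  This one point shows that the
    resultant of 'X times the characteristic polynomial with its derivative is
    not the zero polynomial. *)
Lemma structurally_diagonalizable_cover (R : realType) n (G : digraph n)
    (Z : {set 'I_n}) (s : 'S_n) :
  (forall i, i \in Z -> s i = i) -> (forall i, i \notin Z -> (i, s i) \in G) ->
  (forall i j, i \in Z -> (i, j) \notin G) \/
  (forall i j, j \in Z -> (i, j) \notin G) ->
  structurally_diagonalizable R G.
Proof.
case: n => [|n] in G Z s * => sZ sG GZ.
  apply: aeW => t; rewrite /diagonalizable_over_C [map_mx _ _]flatmx0.
  exact: diagonalizable0.
pose d i : R := (enum_rank (porbit s i)).+1%:R.
pose D : 'M[R]_n.+1 := diag_mx (\row_i (if i \in Z then d i else 0)).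
set m := #|G|; pose T := iter_poly R m.
pose AT : 'M[T]_n.+1 := \matrix_(i, j)
  ((if (i, j) \in G then iter_polyX R m (index (i, j) (enum G)) else 0)
   + iter_polyC R m (D i j)).
pose q := 'X * char_poly AT; pose P := resultant q q^`().
have evAT (t : m.-tuple (measurableTypeR R)) :
    map_mx (iter_eval m t) AT = realization t + D.
  apply/matrixP => i j; rewrite !mxE rmorphD iter_evalC; congr (_ + _).
    case: ifP => ijG; last by rewrite rmorph0.
    by rewrite iter_evalX // /m cardE index_mem mem_enum.
have evq (t : m.-tuple (measurableTypeR R)) :
    map_poly (iter_eval m t) q = 'X * char_poly (realization t + D).
  by rewrite rmorphM /= map_polyX map_char_poly evAT.
have qmon : q \is monic by rewrite /q monicMl ?monicX ?char_poly_monic.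
have sq : size q = n.+3 by rewrite /q mulrC size_mulX ?size_char_poly ?monic_neq0 ?char_poly_monic.
have cq' : q^`()`_n.+1 = n.+2%:R.
  by rewrite coef_deriv -[n.+2]/(n.+3.-1) -sq -lead_coefE (monicP qmon).
have nz k : k.+1%:R != 0 :> T.
  apply/eqP => /(congr1 (iter_eval m [::])); rewrite rmorph_nat rmorph0 => /eqP.
  by rewrite pnatr_eq0.
(* in characteristic zero, differentiation lowers the size by exactly one *)
have lq' : lead_coef q^`() = n.+2%:R.
  have le : (size q^`() <= n.+2)%N by rewrite -ltnS -sq lt_size_deriv ?monic_neq0.
  have ge : (n.+1 < size q^`())%N.
    by rewrite ltnNge; apply/negP => /leq_sizeP/(_ _ (leqnn _))/eqP; rewrite cq' (negPf (nz _)).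
  have sq' : size q^`() = n.+2 by apply/eqP; rewrite eqn_leq le ge.
  by rewrite lead_coefE sq'.
have evP (t : m.-tuple (measurableTypeR R)) : (iter_eval m t P != 0) =
    separable_poly ('X * char_poly (realization t + D)).
  rewrite /P resultant_rmorphism ?lq' ?(monicP qmon) ?rmorph1 ?rmorph_nat ?oner_neq0 ?pnatr_eq0 //.
  rewrite -deriv_map evq resultant_eq0 -leqNgt.
  have -> (p : {poly R}) : separable_poly p = (size (gcdp p p^`()) == 1)%N by rewrite unlock.
  rewrite eqn_leq lt0n size_poly_eq0 gcdp_eq0 -evq.
  by rewrite (negPf (monic_neq0 (monic_map _ qmon))) andbT.
have P0 : P != 0.
  (* weight d i on the edges (i, s i) outside Z, zero on all other edges *)
  pose t0 := [tuple (let e := tnth (enum_tuple (mem G)) k in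
      if (e.1 \notin Z) && (e.2 == s e.1) then d e.1 else 0) : measurableTypeR R | k < m].
  suff : iter_eval m t0 P != 0 by apply: contraNneq => ->; rewrite rmorph0.
  rewrite evP (_ : _ + D = weighted_perm_mx s d) ?separable_char_poly_labelled_perm //.
  apply/matrixP => i j; rewrite !mxE.
  have -> : (if (i, j) \in G then nth 0 t0 (index (i, j) (enum G)) else 0) =
      (if (i \notin Z) && (j == s i) then d i else 0).
    case: ifP => [ijG|/negP ijG]; last first.
      by case: ifP => // /andP[iZ /eqP ji]; case: ijG; rewrite ji sG.
    have lt : (index (i, j) (enum G) < m)%N by rewrite /m cardE index_mem mem_enum.
    rewrite -[index _ _]/(nat_of_ord (Ordinal lt)) -tnth_nth tnth_mktuple.
    by rewrite (tnth_nth (i, j)) /= nth_index ?mem_enum.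
  have [iZ|iZ] /= := boolP (i \in Z); first by rewrite add0r (sZ i iZ) eq_sym.
  by rewrite mul0rn addr0; case: eqP.
have := ae_iter_eval_neq0 P0; apply: filterS => t.
rewrite evP /diagonalizable_over_C => sep.
apply: (@diagonalizable_shift _ _ _ (map_mx (real_complex R) D)); last first.
  by rewrite -map_mxD -map_char_poly -(map_polyX (real_complex R)) -rmorphM separable_map.
have [GZ'|GZ'] := GZ; [left|right]; rewrite -map_mxM (_ : _ *m _ = 0) ?map_mx0 //.
  apply/matrixP => i j; rewrite mul_diag_mx !mxE.
  by have [iZ|iZ] := boolP (i \in Z); rewrite ?mul0r // (negPf (GZ' _ _ iZ)) mulr0.
apply/matrixP => i j; rewrite mul_mx_diag !mxE.
by have [jZ|jZ] := boolP (j \in Z); rewrite ?mulr0 // (negPf (GZ' _ _ jZ)) mul0r.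
Qed.

(** * Hall's theorem and minimal obstructions to cycle covers *)

Section MarriageTheorem.
Local Open Scope nat_scope.

Section Hall.
Variable T : finType.
Implicit Types (e : rel T) (A B S X : {set T}).

Definition nbrs e A := [set j | [exists i in A, e i j]].

Lemma nbrsP e A j : reflect (exists2 i, i \in A & e i j) (j \in nbrs e A).
Proof. by rewrite inE; apply: (iffP exists_inP) => -[i iA eij]; exists i. Qed.

Lemma nbrsS e A B : A \subset B -> nbrs e A \subset nbrs e B.
Proof.
by move=> /fintype.subsetP AB; apply/fintype.subsetP => j /nbrsP[i iA eij]; apply/nbrsP; exists i; rewrite ?AB.
Qed.

(** Halmos and Vaughan's induction.  If some nonempty proper subset is tight, match
    it inside its neighbourhood and match the rest outside; if none is tight,
    any edge can be removed together with its ends. *)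
Theorem Hall_marriage e X :
  (forall A, A \subset X -> #|A| <= #|nbrs e A|) ->
  exists2 f : T -> T, {in X &, injective f} & {in X, forall x, e x (f x)}.
Proof.
have [k] := ubnP #|X|; elim: k => // k IHk in e X *; rewrite ltnS => leXk hallX.
have [->|/set0Pn[x xX]] := eqVneq X finset.set0.
  by exists id => [x y|x]; rewrite inE.
have [/existsP[A /and4P[AX A0 AneqX /eqP NA]]|tight] :=
  boolP [exists A : {set T}, [&& A \subset X, A != finset.set0, A != X & #|nbrs e A| == #|A|]].
  have AltX : #|A| < #|X| by rewrite proper_card // finset.properEneq AneqX.
  have A_gt0 : 0 < #|A| by rewrite card_gt0.
  have [f1 f1inj ef1] : exists2 f : T -> T, {in A &, injective f} & {in A, forall x, e x (f x)}.
    apply: IHk; first exact: leq_trans AltX leXk.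
    by move=> B BA; apply: hallX; apply: fintype.subset_trans AX.
  pose e' i j := e i j && (j \notin nbrs e A).
  have [f2 f2inj ef2] : exists2 f : T -> T, {in X :\: A &, injective f} &
      {in X :\: A, forall x, e x (f x) && (f x \notin nbrs e A)}.
    apply: (IHk e').
      by have := cardsID A X; rewrite (finset.setIidPr AX); lia.
    move=> B; rewrite subsetD => /andP[BX BA].
    have := hallX (A :|: B); rewrite finset.subUset AX BX => /(_ isT).
    rewrite cardsU disjoint_setI0 1?disjoint_sym // cards0 subn0.
    have : nbrs e (A :|: B) \subset nbrs e A :|: nbrs e' B.
      apply/fintype.subsetP => j /nbrsP[i iAB eij]; move: iAB; rewrite !inE => /orP[iA|iB].
        by apply/orP; left; apply/exists_inP; exists i.
      case: (boolP [exists i in A, e i j]) => //= jA; apply/exists_inP; exists i => //.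
      by rewrite /e' eij inE.
    by move=> /subset_leq_card; have [+ _] := leq_card_setU (nbrs e A) (nbrs e' B); lia.
  exists (fun x => if x \in A then f1 x else f2 x).
    move=> y z yX zX /=; case: ifP => yA; case: ifP => zA.
    - exact: f1inj.
    - move=> Eyz; have zXA : z \in X :\: A by rewrite inE zA zX.
      have /andP[_ /negP zN] := ef2 z zXA; case: zN.
      by rewrite -Eyz; apply/nbrsP; exists y => //; apply: ef1.
    - move=> Eyz; have yXA : y \in X :\: A by rewrite inE yA yX.
      have /andP[_ /negP yN] := ef2 y yXA; case: yN.
      by rewrite Eyz; apply/nbrsP; exists z => //; apply: ef1.
    - by apply: f2inj; rewrite inE ?yA ?zA.
  move=> y yX /=; case: ifP => yA; first exact: ef1.
  have yXA : y \in X :\: A by rewrite inE yA yX.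
  by have /andP[] := ef2 y yXA.
have [y exy] : exists y, e x y.
  have : 0 < #|nbrs e [set x]| by have := hallX [set x]; rewrite finset.sub1set xX cards1; apply.
  by case/card_gt0P => y /nbrsP[i /set1P -> exy]; exists y.
pose e' i j := e i j && (j != y).
have [f finj ef] : exists2 f : T -> T, {in X :\ x &, injective f} &
    {in X :\ x, forall z, e z (f z) && (f z != y)}.
  apply: (IHk e'); first by have := cardsD1 x X; rewrite xX; lia.
  move=> B; rewrite subsetD1 => /andP[BX xB].
  have [->|B0] := eqVneq B finset.set0; first by rewrite cards0.
  have BneqX : B != X by apply: contraNneq xB => ->.
  have : #|nbrs e B| != #|B|.
    by move: tight; rewrite negb_exists => /forallP/(_ B); rewrite BX B0 BneqX.
  have := hallX _ BX; have : nbrs e B :\ y \subset nbrs e' B.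
    apply/fintype.subsetP => j; rewrite !inE => /andP[jy /exists_inP[i iB eij]].
    by apply/exists_inP; exists i; rewrite // /e' eij.
  by move=> /subset_leq_card; have := cardsD1 y (nbrs e B); lia.
exists (fun z => if z == x then y else f z).
  move=> u v uX vX /=; case: eqP => [->|/eqP ux]; case: eqP => [->|/eqP vx] //.
  - move=> Ey; have vXx : v \in X :\ x by rewrite !inE vx.
    by have /andP[_] := ef v vXx; rewrite Ey eqxx.
  - move=> Ey; have uXx : u \in X :\ x by rewrite !inE ux.
    by have /andP[_] := ef u uXx; rewrite Ey eqxx.
  - by apply: finj; rewrite !inE ?ux ?vx.
move=> u uX /=; case: eqP => [->//|/eqP ux].
have uXx : u \in X :\ x by rewrite !inE ux.
by have /andP[] := ef u uXx.
Qed.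

Definition cycle_cover e S :=
  [exists s : {perm T}, perm_on S s && [forall i in S, e i (s i)]].

(** The shape of a smallest violation of Hall's condition within [S]: all neighbours
    of [A] lie in [B], which is one element smaller, and none of them
    is the neighbour of a single element of [A] only. *)
Definition sparse_pair e S A B :=
  [&& A \subset S, B \subset S, 1 < #|A|, #|B|.+1 == #|A|, (#|A|).*2 <= #|S|.+1,
      [forall i in A, forall j in S :\: B, ~~ e i j] &
      [forall j in B, 1 < #|[set i in A | e i j]|]].

Definition nbrs_in e S A := nbrs (fun i j => e i j && (j \in S)) A.

Lemma nbrs_inP e S A j :
  reflect (exists2 i, i \in A & e i j && (j \in S)) (j \in nbrs_in e S A).
Proof. exact: nbrsP. Qed.

(** Deleting one element of [A] restores Hall's condition, so the deficiency is one.
    If some vertex of the neighbourhood had a single neighbour in [A], deleting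
    that neighbour would leave a smaller violation.  The complement of the neighbourhood
    violates the condition on the other side, which bounds the size of [A]. *)
Lemma sparse_pair_minimal e S A :
  (forall i, i \in S -> exists2 j, j \in S & e i j) ->
  A \subset S -> #|nbrs_in e S A| < #|A| ->
  (forall A', A' \subset S -> #|A'| < #|A| -> #|A'| <= #|nbrs_in e S A'|) ->
  (forall A', A' \subset S -> #|A'| < #|A| ->
     #|A'| <= #|nbrs_in (fun i j => e j i) S A'|) ->
  sparse_pair e S A (nbrs_in e S A).
Proof.
move=> rowS AS NA minr minc; set B := nbrs_in e S A.
have BS : B \subset S by apply/fintype.subsetP => j /nbrs_inP[i _ /andP[]].
have delA a : a \in A -> #|A|.-1 <= #|nbrs_in e S (A :\ a)|.
  move=> aA; have := cardsD1 a A; rewrite aA => cA.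
  rewrite cA add1n /= minr ?cA //.
  by apply: fintype.subset_trans AS; rewrite subD1set.
have /card_gt0P[a0 a0A] : 0 < #|A| by apply: leq_ltn_trans NA.
have cB : #|B|.+1 = #|A|.
  have := delA _ a0A; have := subset_leq_card (nbrsS (fun i j => e i j && (j \in S)) (subD1set A a0)).
  by move: NA; rewrite /nbrs_in -/(nbrs_in e S A) -/B /B /nbrs_in; lia.
have A_gt1 : 1 < #|A|.
  rewrite -cB ltnS; have [j jS ej] := rowS a0 (fintype.subsetP AS _ a0A).
  by apply/card_gt0P; exists j; apply/nbrs_inP; exists a0; rewrite ?ej.
rewrite /sparse_pair AS BS A_gt1 cB eqxx /=; apply/and3P; split.
- have := cardsID B S; rewrite (finset.setIidPr BS) => cS.
  have AltS := subset_leq_card AS.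
  rewrite leqNgt; apply/negP => lt.
  have := minc (S :\: B) (subsetDl _ _).
  have : nbrs_in (fun i j => e j i) S (S :\: B) \subset S :\: A.
    apply/fintype.subsetP => j /nbrs_inP[i iSB /andP[eji jS]].
      move: iSB; rewrite !finset.in_setD => /andP[iB iS].
    rewrite jS andbT; apply: contra iB => jA.
    by apply/nbrs_inP; exists j; rewrite ?eji.
  move=> /subset_leq_card; have := cardsID A S; rewrite (finset.setIidPr AS).
  by move: lt; rewrite -addnn; lia.
- apply/forall_inP => i iA; apply/forall_inP => j; rewrite finset.in_setD => /andP[jB jS].
  by apply: contra jB => eij; apply/nbrs_inP; exists i; rewrite ?eij.
- apply/forall_inP => b bB; have /nbrs_inP[a aA /andP[eab bS]] := bB.
  rewrite ltnNge; apply/negP => le1.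
  have sub : nbrs_in e S (A :\ a) \subset B :\ b.
    apply/fintype.subsetP => j /nbrs_inP[i iAa /andP[eij jS]].
      move: iAa; rewrite !in_setD1 => /andP[ia iA].
    apply/andP; split; last by apply/nbrs_inP; exists i; rewrite ?eij.
    apply: contraNneq ia => jb; rewrite jb in eij.
    have /card_le1P/(_ a) := le1; rewrite inE aA eab => /(_ isT)/(_ i).
    by rewrite !inE iA eij => /esym.
  have := delA a aA; have := subset_leq_card sub; have := cardsD1 b B; rewrite bB; lia.
Qed.

Lemma cycle_coverN_sparse_pair e S :
  (forall i, i \in S -> exists2 j, j \in S & e i j) ->
  (forall j, j \in S -> exists2 i, i \in S & e i j) ->
  ~~ cycle_cover e S ->
  (exists A B, sparse_pair e S A B) \/
  (exists A B, sparse_pair (fun i j => e j i) S A B).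
Proof.
move=> rowS colS ncover.
pose viol e' k := [exists A : {set T}, [&& A \subset S, #|A| == k & #|nbrs_in e' S A| < k]].
have ex : exists k, viol e k || viol (fun i j => e j i) k.
  have [/existsP[A /andP[AS NA]]|/existsPn noviol] := boolP [exists A : {set T},
      (A \subset S) && (#|nbrs_in e S A| < #|A|)].
    by exists #|A|; apply/orP; left; apply/existsP; exists A; rewrite AS eqxx.
  have [|f finj ef] := @Hall_marriage (fun i j => e i j && (j \in S)) S.
    by move=> A AS; have := noviol A; rewrite AS /= -leqNgt.
  case/negP: ncover; pose g x := if x \in S then f x else x.
  have ginj : injective g.
    move=> x y; rewrite /g; case: ifP => xS; case: ifP => yS.
    - exact: finj.
    - by move=> Exy; have /andP[_] := ef x xS; rewrite Exy yS.
    - by move=> Exy; have /andP[_] := ef y yS; rewrite -Exy xS.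
    - by [].
  apply/existsP; exists (perm ginj); apply/andP; split.
    apply/fintype.subsetP => x; rewrite !inE permE /g; case: ifP => //; by rewrite eqxx.
  by apply/forall_inP => i iS; rewrite permE /g iS; have /andP[] := ef i iS.
(* a smallest violation, among those of rows and of columns *)
have min := ex_minnP ex.
case: min => k /orP[] /existsP[A /and3P[AS /eqP cA NA]] kmin; [left|right];
  exists A; eexists; apply: sparse_pair_minimal => //; rewrite ?cA // => A' A'S ltk;
  rewrite leqNgt; apply/negP => NA'; move: ltk; rewrite ltnNge => /negP[];
  apply: kmin; apply/orP; [left|right|right|left]; apply/existsP; exists A';
  by rewrite A'S eqxx.
Qed.

End Hall.

End MarriageTheorem.

(** * Expectations over random subsets *)

Lemma finset_ind (T : finType) (P : {set T} -> Prop) :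
  P finset.set0 -> (forall x (A : {set T}), x \notin A -> P A -> P (x |: A)) -> forall A, P A.
Proof.
move=> P0 PU A; have [k] := ubnP #|A|; elim: k => // k IHk in A *.
have [->//|/set0Pn[x xA]] := eqVneq A finset.set0.
rewrite (cardsD1 x) xA ltnS add1n -{2}(finset.setD1K xA) => ltk.
by apply: PU; [rewrite !inE eqxx | apply: IHk].
Qed.

Section Expectation.
Variables (R : realDomainType) (E : finType) (w : E -> R).
Hypothesis w01 : forall e, 0 <= w e <= 1.
Implicit Types (D F G : {set E}) (f g : {set E} -> R).

Definition subset_mass D G : R := \prod_(e in D) (if e \in G then w e else 1 - w e).

(** The expectation of [f] when each element of [D] is kept independently with
    probability [w]. *)
Definition expect D f : R := \sum_(G : {set E} | G \subset D) subset_mass D G * f G.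

Lemma eq_expect D f g : (forall G, G \subset D -> f G = g G) -> expect D f = expect D g.
Proof. by move=> fg; apply: eq_bigr => G GD; rewrite fg. Qed.

Lemma expect_set0 f : expect finset.set0 f = f finset.set0.
Proof.
rewrite /expect (bigD1 finset.set0) ?finset.sub0set //= /subset_mass big_set0 mul1r big1 ?addr0 //.
by move=> G; rewrite finset.subset0 => /andP[/eqP-> /eqP].
Qed.

Lemma expect_setU1 e D f : e \notin D ->
  expect (e |: D) f = w e * expect D (fun G => f (e |: G)) + (1 - w e) * expect D f.
Proof.
move=> eD; rewrite /expect (bigID (fun G : {set E} => e \in G)) /=.
have massU G : subset_mass (e |: D) G =
    (if e \in G then w e else 1 - w e) * subset_mass D G.
  by rewrite /subset_mass big_setU1.
congr (_ + _); rewrite mulr_sumr.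
  rewrite (reindex_onto (fun G => e |: G) (fun G => G :\ e)) /=; last first.
    by move=> G /andP[_ eG]; rewrite finset.setD1K.
  apply: eq_big => [G|G /andP[/andP[GD _] /eqP EG]].
    rewrite setU11 andbT; have [eG|eG] := boolP (e \in G).
      rewrite (_ : G \subset D = false); last first.
        by apply: contraNF eD => /fintype.subsetP/(_ e eG).
      by apply: contraTF eG => /andP[_ /eqP<-]; rewrite !inE eqxx.
    rewrite setU1K // eqxx andbT; apply/fintype.subsetP/fintype.subsetP => GD x xG.
      have := GD x; rewrite !inE xG orbT => /(_ isT) /predU1P[xe|//].
      by move: eG; rewrite -xe xG.
    by move: xG; rewrite !inE => /predU1P[->|/GD ->]; rewrite ?eqxx ?orbT.
  rewrite massU setU11 mulrA; congr (_ * _ * _).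
  apply: eq_bigr => x xD; rewrite !inE; case: eqP => // xe.
  by move: eD; rewrite -xe xD.
apply: eq_big => [G|G /andP[_ /negPf eG]]; last by rewrite massU eG mulrA.
apply/andP/idP => [[GD eG]|GD].
  apply/fintype.subsetP => x xG; have := fintype.subsetP GD x xG; rewrite !inE => /predU1P[xe|//].
  by move: eG; rewrite -xe xG.
split; first by apply: fintype.subset_trans GD (subsetU1 _ _).
by apply: contra eD => /(fintype.subsetP GD).
Qed.

Lemma subset_mass_ge0 D G : 0 <= subset_mass D G.
Proof.
apply: prodr_ge0 => e _; have /andP[w0 w1] := w01 e.
by case: ifP => _ //; rewrite subr_ge0.
Qed.

Lemma le_expect D f g : (forall G, f G <= g G) -> expect D f <= expect D g.
Proof. by move=> fg; apply: ler_sum => G _; rewrite ler_wpM2l ?subset_mass_ge0. Qed.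

Lemma expect_cst D c : expect D (fun=> c) = c.
Proof.
elim/finset_ind: D => [|e D eD IHD]; first by rewrite expect_set0.
by rewrite expect_setU1 // IHD; ring.
Qed.

Lemma expect_ge0 D f : (forall G, 0 <= f G) -> 0 <= expect D f.
Proof. by move=> f0; rewrite -(expect_cst D 0); apply: le_expect. Qed.

Lemma expectD D f g : expect D (fun G => f G + g G) = expect D f + expect D g.
Proof. by rewrite /expect -big_split; apply: eq_bigr => G _; rewrite mulrDr. Qed.

Lemma expectB D f g : expect D (fun G => f G - g G) = expect D f - expect D g.
Proof.
by rewrite /expect -sumrB; apply: eq_bigr => G _; rewrite mulrBr.
Qed.

Lemma expect_sum D (I : Type) (r : seq I) (P : pred I) (f : I -> {set E} -> R) :
  expect D (fun G => \sum_(i <- r | P i) f i G) = \sum_(i <- r | P i) expect D (f i).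
Proof.
rewrite /expect exchange_big /=; apply: eq_bigr => G _; by rewrite mulr_sumr.
Qed.

Definition increasing_in f := forall G G', G \subset G' -> f G <= f G'.

(** Harris' inequality.  Conditioning on one element, the induction step reduces to
    Chebyshev's inequality for two numbers: the conditional expectations of
    [f] and [g] move in the same direction. *)
Lemma harris D f g : increasing_in f -> increasing_in g ->
  expect D f * expect D g <= expect D (fun G => f G * g G).
Proof.
elim/finset_ind: D f g => [|e D eD IHD] f g fi gi; first by rewrite !expect_set0.
rewrite !expect_setU1 //; have /andP[w0 w1] := w01 e.
have shift (h : {set E} -> R) : increasing_in h -> increasing_in (fun G => h (e |: G)).
  by move=> hi G G' GG'; apply: hi; apply: finset.setUS.
have step (h : {set E} -> R) : increasing_in h -> expect D h <= expect D (fun G => h (e |: G)).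
  by move=> hi; apply: le_expect => G; apply: hi; apply: subsetU1.
have := IHD _ _ fi gi; have := IHD _ _ (shift _ fi) (shift _ gi).
have := step _ fi; have := step _ gi.
move: (expect D f) (expect D g) (expect D (fun G => f (e |: G))).
move: (expect D (fun G => g (e |: G))) (expect D (fun G => f G * g G)).
move: (expect D (fun G => f (e |: G) * g (e |: G))) (w e) w0 w1 => x1 v v0 v1 b1 x0 a0 b0 a1 lb la l1 l0.
have : v * (a1 * b1) <= v * x1 by rewrite ler_wpM2l.
have : (1 - v) * (a0 * b0) <= (1 - v) * x0 by rewrite ler_wpM2l // subr_ge0.
(* the covariance of two monotone functions of one random bit *)
have : 0 <= v * (1 - v) * ((a1 - a0) * (b1 - b0)) by rewrite !mulr_ge0 ?subr_ge0.
nra.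
Qed.

Lemma harris_prod D (I : eqType) (r : seq I) (f : I -> {set E} -> R) :
  (forall i, increasing_in (f i)) -> (forall i G, 0 <= f i G) ->
  \prod_(i <- r) expect D (f i) <= expect D (fun G => \prod_(i <- r) f i G).
Proof.
move=> fi f0; elim: r => [|i r IHr].
  by rewrite big_nil (eq_expect (g := fun=> 1)) ?expect_cst // => G _; rewrite big_nil.
have -> : expect D (fun G => \prod_(j <- i :: r) f j G) =
    expect D (fun G => f i G * \prod_(j <- r) f j G).
  by apply: eq_expect => G _; rewrite big_cons.
rewrite big_cons.
apply: le_trans (harris _ (fi i) _); first by rewrite ler_wpM2l ?expect_ge0.
by move=> G G' GG'; apply: ler_prod => j _; rewrite f0 fi.
Qed.

Definition insensitive e f := forall G, f (e |: G) = f G.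

Lemma insensitive_shift e e' f :
  insensitive e' f -> insensitive e' (fun G => f (e |: G)).
Proof. by move=> fe G; rewrite finset.setUCA fe. Qed.

(** The induction of Harris' inequality, in which one of the two increments is now
    zero at each step. *)
Lemma expect_indep D f g : (forall e, insensitive e f \/ insensitive e g) ->
  expect D (fun G => f G * g G) = expect D f * expect D g.
Proof.
elim/finset_ind: D f g => [|e D eD IHD] f g fg; first by rewrite !expect_set0.
rewrite !expect_setU1 //.
have /= -> := IHD (fun G => f (e |: G)) (fun G => g (e |: G)); last first.
  by move=> e'; case: (fg e'); [left|right]; apply: insensitive_shift.
rewrite IHD //; case: (fg e) => h; rewrite (eq_expect (fun G _ => h G)); ring.
Qed.

Lemma expect_indep_prod D (I : eqType) (r : seq I) (f : I -> {set E} -> R) :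
  uniq r ->
  (forall i j e, i != j -> insensitive e (f i) \/ insensitive e (f j)) ->
  expect D (fun G => \prod_(i <- r) f i G) = \prod_(i <- r) expect D (f i).
Proof.
move=> ur fr; elim: r ur => [_|i r IHr /= /andP[ir ur]].
  by rewrite big_nil -[RHS](expect_cst D); apply: eq_expect => G _; rewrite big_nil.
rewrite big_cons -IHr // -expect_indep; first by apply: eq_expect => G _; rewrite big_cons.
move=> e; have [/allP all_r|/allPn[j jr nj]] :=
  boolP (all (fun j => [forall G : {set E}, f j (e |: G) == f j G]) r).
  right=> G; rewrite !big_seq; apply: eq_bigr => j jr.
  by apply/eqP; have /forallP := all_r j jr; apply.
left; have ij : i != j by apply: contraNneq ir => ->.
case: (fr i j e ij) => // ins; case/negP: nj; apply/forallP => G.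
by rewrite ins.
Qed.

Lemma expect_mem D e : e \in D -> expect D (fun G => (e \in G)%:R) = w e.
Proof.
move=> eD; rewrite -(finset.setD1K eD) expect_setU1 ?inE ?eqxx //.
rewrite (eq_expect (g := fun=> 1)) ?expect_cst; last by move=> G _; rewrite setU11.
rewrite (eq_expect (g := fun=> 0)) ?expect_cst; first by rewrite mulr0 addr0 mulr1.
move=> G /fintype.subsetP GD; rewrite (_ : e \in G = false) //.
by apply/negP => /GD; rewrite !inE eqxx.
Qed.

Lemma expect_notin D e : e \in D -> expect D (fun G => (e \notin G)%:R) = 1 - w e.
Proof.
move=> eD; rewrite -[1 in RHS](expect_cst D) -(expect_mem eD) -expectB.
by apply: eq_expect => G _; case: (e \in G); rewrite ?subrr ?subr0.
Qed.

End Expectation.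

(** * Null lines and sparse pairs in the random digraph *)

(** The k-th elementary symmetric sum is at most t^-k times the product of the
    1 + t x_i, hence at most t^-k exp (t X), for every t > 0; the best choice is
    t = k / X. *)
Lemma sum_prod_card_le (R : realType) (I : finType) (x : I -> R) k X :
  (forall i, 0 <= x i) -> \sum_i x i <= X -> 0 < X -> (0 < k)%N ->
  \sum_(B : {set I} | #|B| == k) \prod_(i in B) x i <= (expR 1 * X / k%:R) ^+ k.
Proof.
move=> x0 xX X0 k0; have kR : 0 < k%:R :> R by rewrite ltr0n.
pose t := k%:R / X; have t0 : 0 < t by rewrite divr_gt0.
suff le : t ^+ k * (\sum_(B : {set I} | #|B| == k) \prod_(i in B) x i) <= expR 1 ^+ k.
  rewrite -(ler_pM2l (exprn_gt0 k t0)) -exprMn.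
  by rewrite (_ : t * _ = expR 1) // /t; field; rewrite !gt_eqF.
have tx0 i : 0 <= t * x i by rewrite mulr_ge0 // ltW.
have -> : t ^+ k * (\sum_(B : {set I} | #|B| == k) \prod_(i in B) x i) =
    \sum_(B : {set I} | #|B| == k) \prod_(i in B) (t * x i).
  rewrite mulr_sumr; apply: eq_bigr => B /eqP <-.
  by rewrite big_split /= prodr_const.
apply: (@le_trans _ _ (\sum_(B : {set I}) \prod_(i in B) (t * x i))).
  rewrite [leRHS](bigID (fun B : {set I} => #|B| == k)) /= lerDl.
  by apply: sumr_ge0 => B _; apply: prodr_ge0.
have -> : \sum_(B : {set I}) \prod_(i in B) (t * x i) = \prod_i (t * x i + 1).
  rewrite bigA_distr; apply: eq_big => [B|B _]; first by rewrite inE.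
  by rewrite big_mkcond.
apply: (@le_trans _ _ (\prod_i expR (t * x i))).
  apply: ler_prod => i _; rewrite addr_ge0 //= addrC.
  exact: expR_ge1Dx.
rewrite -expR_sum -mulr_sumr -expRM_natl mulr1 ler_expR.
by apply: le_trans (ler_wpM2l (ltW t0) xX) _; rewrite /t divfK ?gt_eqF.
Qed.

Lemma prod_setX (R : comNzRingType) (I J : finType) (A : {set I}) (B : {set J})
    (F : I * J -> R) :
  \prod_(e in finset.setX A B) F e = \prod_(i in A) \prod_(j in B) F (i, j).
Proof. by rewrite pair_big /=; apply: eq_big => [[i j]|[i j] _]; rewrite ?inE. Qed.

Section RandomDigraph.
Variables (R : realType) (n : nat) (p q : R).
Hypotheses (p01 : 0 <= p <= 1) (q01 : 0 <= q <= 1).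
Local Notation cell := ('I_n * 'I_n)%type.
Local Notation w := (@edge_prob R n p q).
Local Notation EE := (expect w [set: cell]).

Lemma edge_prob01 e : 0 <= w e <= 1.
Proof. by rewrite /edge_prob; case: ifP. Qed.
Local Hint Resolve edge_prob01 : core.

Lemma digraph_probE (C : set (digraph n)) :
  digraph_prob p q C = EE (fun G => (G \in C)%:R).
Proof.
rewrite /digraph_prob /expect big_mkcond [RHS]big_mkcond /=; apply: eq_bigr => G _.
rewrite finset.subsetT /digraph_mass /subset_mass.
have -> : \prod_(e in [set: cell]) (if e \in G then w e else 1 - w e) =
  \prod_(e : cell) (if e \in G then w e else 1 - w e).
  by apply: eq_bigl => e; rewrite inE.
by case: (G \in C); rewrite ?mulr1 ?mulr0.
Qed.

(** Rows and columns are treated at once by reading cells through a symmetry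
    [tau]: the identity for rows, the exchange of coordinates for columns.
    Self-loops have to be preserved because their probability is different. *)
Definition diag_symmetry (tau : cell -> cell) :=
  injective tau /\ forall e, (tau e).1 == (tau e).2 = (e.1 == e.2).

Lemma diag_symmetry_id : diag_symmetry id. Proof. by split. Qed.

Lemma diag_symmetry_swap : diag_symmetry (fun e => (e.2, e.1)).
Proof. by split=> [[i j] [i' j'] [-> ->]|[i j]] //=; rewrite eq_sym. Qed.

Variable tau : cell -> cell.
Hypothesis tauP : diag_symmetry tau.

Lemma edge_prob_sym e : w (tau e) = w e.
Proof. by case: tauP => _ te; rewrite /edge_prob te. Qed.

Lemma tau_inj : injective tau. Proof. by case: tauP. Qed.

Lemma insensitive_mem e e' (h : bool -> R) : e != e' ->
  insensitive e (fun G : {set cell} => h (e' \in G)).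
Proof. by move=> ee' G; rewrite !inE eq_sym (negPf ee'). Qed.

Lemma insensitive_prod (I : Type) e (r : seq I) (P : pred I) (f : I -> {set cell} -> R) :
  (forall i, P i -> insensitive e (f i)) ->
  insensitive e (fun G => \prod_(i <- r | P i) f i G).
Proof. by move=> fe G; apply: eq_bigr => i /fe. Qed.

Lemma expect_absent (F : {set cell}) :
  EE (fun G => \prod_(e in F) (tau e \notin G)%:R) = \prod_(e in F) (1 - w e).
Proof.
have -> : EE (fun G => \prod_(e in F) (tau e \notin G)%:R) =
    EE (fun G => \prod_(e <- enum F) (tau e \notin G)%:R).
  by apply: eq_expect => G _; rewrite big_enum.
rewrite (@expect_indep_prod R _ w [set: cell] _ (enum F)
  (fun e (G : {set cell}) => (tau e \notin G)%:R : R) (enum_uniq _)); last first.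
  move=> e e' x ee'; have [->|xe] := eqVneq x (tau e).
    by right; apply: (insensitive_mem (fun b => (~~ b)%:R)); rewrite (inj_eq tau_inj).
  by left; apply: (insensitive_mem (fun b => (~~ b)%:R)).
by rewrite big_enum /=; apply: eq_bigr => e _; rewrite expect_notin ?inE // edge_prob_sym.
Qed.

Definition hit i (S : {set 'I_n}) (G : {set cell}) : bool :=
  [exists j in S, tau (i, j) \in G].

Lemma hitN_prod i S (G : {set cell}) :
  (~~ hit i S G)%:R = \prod_(e in finset.setX [set i] S) (tau e \notin G)%:R :> R.
Proof.
have [/exists_inP[j jS ij]|/exists_inPn nohit] := boolP (hit i S G).
  by rewrite (bigD1 (i, j)) ?inE ?eqxx //= ij mul0r.
by rewrite big1 // => -[i' j]; rewrite !inE /= => /andP[/eqP-> jS]; rewrite nohit.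
Qed.

(** One factor may be a self-loop, of unknown probability; dropping it costs one
    cell, whence the strict inequality. *)
Lemma prod_row_le (i : 'I_n) (C : {set 'I_n}) k : (k < #|C|)%N ->
  \prod_(j in C) (1 - w (i, j)) <= (1 - p) ^+ k.
Proof.
move=> kC; have /andP[p0 p1] := p01; have /andP[q0 q1] := q01.
have le (D : {set 'I_n}) : (k <= #|D|)%N -> i \notin D ->
    \prod_(j in D) (1 - w (i, j)) <= (1 - p) ^+ k.
  move=> kD iD; rewrite (eq_bigr (fun=> 1 - p)); last first.
    move=> j jD; rewrite /edge_prob /=; case: eqP => // ij.
    by move: iD; rewrite ij jD.
  rewrite prodr_const; apply: ler_wiXn2l => //; first by rewrite subr_ge0.
  by rewrite gerBl.
have [iC|iC] := boolP (i \in C); last by apply: le => //; apply: ltnW.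
rewrite (big_setD1 i) //=.
have leD := le (C :\ i); apply: le_trans (leD _ _); last 2 first.
- by move: kC; rewrite (cardsD1 i) iC.
- by rewrite !inE eqxx.
rewrite ler_piMl //.
  by apply: prodr_ge0 => j _; rewrite subr_ge0; have /andP[] := edge_prob01 (i, j).
by rewrite gerBl; have /andP[] := edge_prob01 (i, i).
Qed.

Lemma prod_row_in (i : 'I_n) (S : {set 'I_n}) : i \in S ->
  \prod_(j in S) (1 - w (i, j)) = (1 - q) * (1 - p) ^+ #|S|.-1.
Proof.
move=> iS; rewrite (big_setD1 i) //= /edge_prob /= eqxx; congr (_ * _).
rewrite (eq_bigr (fun=> 1 - p)) ?prodr_const; first by have := cardsD1 i S; rewrite iS => ->.
by move=> j; rewrite !inE => /andP[/negPf ji _]; rewrite eq_sym ji.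
Qed.

Lemma expect_hit i (S : {set 'I_n}) : i \in S ->
  EE (fun G => (hit i S G)%:R) = 1 - (1 - q) * (1 - p) ^+ #|S|.-1.
Proof.
move=> iS; rewrite -(prod_row_in iS).
have -> : \prod_(j in S) (1 - w (i, j)) = EE (fun G => (~~ hit i S G)%:R).
  rewrite (@eq_expect _ _ _ _ _ (fun G =>
    \prod_(e in finset.setX [set i] S) (tau e \notin G)%:R)) ?expect_absent; last first.
    by move=> G _; exact: hitN_prod.
  by rewrite prod_setX big_set1.
rewrite -[X in _ = X - _](expect_cst w [set: cell] 1) -expectB; apply: eq_expect => G _.
by case: (hit _ _ _); rewrite ?subr0 ?subrr.
Qed.

Lemma increasing_hit i S : increasing_in (fun G => (hit i S G)%:R : R).
Proof.
move=> G G' /fintype.subsetP GG'; rewrite ler_nat; case: (boolP (hit i S G)) => //.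
by case/exists_inP => j jS ij; rewrite (_ : hit i S G') //; apply/exists_inP; exists j; rewrite ?GG'.
Qed.

Lemma expect_all_hit (S : {set 'I_n}) :
  (1 - (1 - q) * (1 - p) ^+ #|S|.-1) ^+ #|S|
    <= EE (fun G => \prod_(i in S) (hit i S G)%:R).
Proof.
have := @harris_prod R _ w edge_prob01 [set: cell] _ (enum S) (fun i G => (hit i S G)%:R)
  (fun i => @increasing_hit i S) (fun i G => ler0n _ _).
rewrite big_enum /= (eq_bigr (fun=> 1 - (1 - q) * (1 - p) ^+ #|S|.-1)); last first.
  by move=> i iS; rewrite expect_hit.
rewrite prodr_const; congr (_ <= _).
by apply: eq_expect => G _; rewrite big_enum.
Qed.

Lemma expect_present e : EE (fun G => (tau e \in G)%:R) = w e.
Proof. by rewrite expect_mem ?inE // edge_prob_sym. Qed.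

(** Two distinct neighbours are either both off the diagonal, or one of them is [j]
    itself and belongs to [A]; the self-loop is then counted with
    probability one. *)
Lemma expect_two_nbrs (A : {set 'I_n}) j :
  EE (fun G => (1 < #|[set i in A | tau (i, j) \in G]|)%:R)
    <= #|A|%:R ^+ 2 * p ^+ 2 + (j \in A)%:R * (#|A|%:R * p).
Proof.
have /andP[p0 p1] := p01.
have woff i : i \in A :\ j -> w (i, j) = p.
  by rewrite !inE /edge_prob /= => /andP[/negPf->].
pose pairs (G : {set cell}) : R := \sum_(i in A :\ j) \sum_(i' in (A :\ j) :\ i)
  (tau (i, j) \in G)%:R * (tau (i', j) \in G)%:R.
pose ones (G : {set cell}) : R := (j \in A)%:R * \sum_(i in A :\ j) (tau (i, j) \in G)%:R.
have bound (G : {set cell}) : (1 < #|[set i in A | tau (i, j) \in G]|)%:R <= pairs G + ones G.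
  have pairs0 : 0 <= pairs G.
    by apply: sumr_ge0 => i _; apply: sumr_ge0 => i' _; rewrite -natrM ler0n.
  have ones0 : 0 <= ones G by rewrite mulr_ge0 // sumr_ge0.
  case: ltnP => [/card_gt1P[x [y [xA yA xy]]]|_]; last by rewrite addr_ge0.
  move: xA yA; rewrite !inE => /andP[xA xG] /andP[yA yG].
  have one z : z \in A -> tau (z, j) \in G -> z != j -> j \in A -> 1 <= ones G.
    move=> zA zG zj jA; rewrite /ones jA mul1r (bigD1 z) ?inE ?zj //= zG lerDl.
    by apply: sumr_ge0.
  have [xj|xj] := eqVneq x j.
    rewrite ler_wpDl // (one y) // -?xj // eq_sym //.
  have [yj|yj] := eqVneq y j; first by rewrite ler_wpDl // (one x) // -yj.
  rewrite ler_wpDr // /pairs (bigD1 x) ?inE ?xj //=.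
  rewrite (bigD1 y) ?inE ?yj ?(eq_sym y) ?xy //= xG yG mulr1 -addrA lerDl addr_ge0 //.
    by apply: sumr_ge0 => i' _; rewrite -natrM ler0n.
  by apply: sumr_ge0 => i _; apply: sumr_ge0 => i' _; rewrite -natrM ler0n.
apply: le_trans (le_expect edge_prob01 _ bound) _.
have cA : #|A :\ j|%:R <= #|A|%:R :> R by rewrite ler_nat subset_leq_card ?subD1set.
rewrite expectD lerD //.
  rewrite expect_sum; apply: (@le_trans _ _ (\sum_(i in A :\ j) #|A|%:R * p ^+ 2)).
    apply: ler_sum => i iA; rewrite expect_sum.
    apply: (@le_trans _ _ (\sum_(i' in A :\ j :\ i) p ^+ 2)).
      apply: ler_sum => i' iA'; rewrite expect_indep; last first.
        move=> e; have [->|ei] := eqVneq e (tau (i, j)).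
          right; apply: (insensitive_mem (fun b => b%:R)).
          rewrite (inj_eq tau_inj) xpair_eqE eqxx andbT.
          by move: iA'; rewrite !inE eq_sym => /andP[].
        by left; apply: (insensitive_mem (fun b => b%:R)).
      rewrite !expect_present woff // woff ?expr2 //.
      by move: iA'; rewrite in_setD1 => /andP[].
    rewrite sumr_const -[leLHS]mulr_natl ler_wpM2r ?exprn_ge0 // ler_nat.
    by apply: subset_leq_card; rewrite !subDset !subsetU ?subxx ?orbT.
  rewrite sumr_const -[leLHS]mulr_natl [_%:R ^+ 2]expr2 -mulrA ler_wpM2r //.
  by rewrite mulr_ge0 // exprn_ge0.
rewrite /ones (_ : expect _ _ _ = (j \in A)%:R * expect w [set: cell]
   (fun G => \sum_(i in A :\ j) (tau (i, j) \in G)%:R)); last first.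
  by rewrite /expect mulr_sumr; apply: eq_bigr => G _; rewrite mulrCA.
rewrite ler_wpM2l // expect_sum (eq_bigr (fun=> p)); last first.
  by move=> i iA; rewrite expect_present woff.
by rewrite sumr_const -[leLHS]mulr_natl ler_wpM2r.
Qed.

Definition rel_of (G : {set cell}) : rel 'I_n := fun i j => tau (i, j) \in G.

(** The absent cells and the columns of the cells from [A] to each [j] in [B] are
    pairwise disjoint, so all the conditions are independent. *)
Lemma expect_sparse_pair (S A B : {set 'I_n}) :
  A \subset S -> B \subset S -> #|B|.+1 = #|A| ->
  EE (fun G => (sparse_pair (rel_of G) S A B)%:R) <=
   ((1 - p) ^+ (#|S| - #|A|)) ^+ #|A| *
   \prod_(j in B) (#|A|%:R ^+ 2 * p ^+ 2 + (j \in A)%:R * (#|A|%:R * p)).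
Proof.
move=> AS BS cAB; have /andP[p0 p1] := p01.
pose absent (G : {set cell}) : R := \prod_(e in finset.setX A (S :\: B)) (tau e \notin G)%:R.
pose two j (G : {set cell}) : R := (1 < #|[set i in A | tau (i, j) \in G]|)%:R.
have bound (G : {set cell}) : (sparse_pair (rel_of G) S A B)%:R <= absent G * \prod_(j <- enum B) two j G.
  have nonneg : 0 <= absent G * \prod_(j <- enum B) two j G.
    by rewrite mulr_ge0 ?prodr_ge0 // => *; rewrite ler0n.
  case: (boolP (sparse_pair _ _ _ _)) => // /and5P[_ _ _ _ /and3P[_ abs tw]].
  rewrite /absent big1 ?mul1r; last first.
    move=> [i j]; rewrite finset.in_setX => /andP[iA jB].
    by have := forall_inP (forall_inP abs i iA) j jB; rewrite /rel_of => ->.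
  rewrite big_enum /= big1 // => j jB.
  by have := forall_inP tw j jB; rewrite /rel_of /two => ->.
apply: le_trans (le_expect edge_prob01 _ bound) _.
have two_ins e j : (forall i, i \in A -> e != tau (i, j)) -> insensitive e (two j).
  move=> ej G; rewrite /two; congr ((1 < #|pred_of_set _|)%:R); apply/setP => i.
  rewrite !inE; case: (boolP (i \in A)) => //= iA.
  by rewrite eq_sym (negPf (ej i iA)).
rewrite expect_indep; last first.
  move=> e; have [/existsP[i /exists_inP[j jB /eqP->]]|/existsPn nex] :=
      boolP [exists i, exists j in B, e == tau (i, j)].
    left; apply: insensitive_prod => -[i' j']; rewrite finset.in_setX !inE => /andP[_ /andP[j'B _]].
    apply: (insensitive_mem (fun b => (~~ b)%:R)); rewrite (inj_eq tau_inj).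
    by apply: contraNneq j'B => -[_ <-].
  right=> G; rewrite !big_seq; apply: eq_bigr => j; rewrite mem_enum => jB.
  apply: two_ins => i _; have := nex i; rewrite negb_exists_in => /forall_inP; exact.
rewrite ler_pM //.
- by apply: expect_ge0 edge_prob01 _ _ _ => G; apply: prodr_ge0 => *; rewrite ler0n.
- by apply: expect_ge0 edge_prob01 _ _ _ => G; apply: prodr_ge0 => *; rewrite ler0n.
- rewrite expect_absent prod_setX -prodr_const; apply: ler_prod => i iA.
  apply/andP; split.
    by apply: prodr_ge0 => j _; rewrite subr_ge0; have /andP[] := edge_prob01 (i, j).
  apply: prod_row_le; have := cardsID B S; rewrite (finset.setIidPr BS).
  have := subset_leq_card AS; lia.
rewrite expect_indep_prod ?enum_uniq //; last first.
  move=> j j' e jj'; have [/exists_inP[i iA /eqP->]|/exists_inPn nex] :=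
      boolP [exists i in A, e == tau (i, j)].
    right; apply: two_ins => i' _; rewrite (inj_eq tau_inj).
    by apply: contraNneq jj' => -[_ ->].
  by left; apply: two_ins.
rewrite big_enum /=; apply: ler_prod => j _; rewrite expect_two_nbrs andbT.
by apply: expect_ge0 edge_prob01 _ _ _ => G; rewrite ler0n.
Qed.

End RandomDigraph.

(** * Probability of a cycle cover *)

Section CoverProbability.
Variables (R : realType) (n : nat) (p q : R).
Hypotheses (p01 : 0 < p <= 1) (q01 : 0 <= q <= 1).
Local Notation cell := ('I_n * 'I_n)%type.
Local Notation w := (@edge_prob R n p q).
Local Notation EE := (expect w [set: cell]).
Local Notation swap := (fun e : cell => (e.2, e.1)).

Let p01' : 0 <= p <= 1. Proof. by case/andP: p01 => /ltW -> ->. Qed.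

(** A bound for the expected number of sparse pairs with [k] lines in a set of [m]
    vertices: the first factor bounds the number of choices of the [k] lines,
    the second the weighted sum over the sets of [k - 1] neighbours, the third
    the probability that no other cell of these lines is present. *)
Definition hall_term m k : R :=
  (expR 1 * n%:R / k%:R) ^+ k *
  ((expR 1 * (k%:R ^+ 2 * p * (n%:R * p + 1)) / k.-1%:R) ^+ k.-1) *
  ((1 - p) ^+ (m - k)) ^+ k.

(** The sums over [B] and over [A] are elementary symmetric sums, of the
    probabilities of having two neighbours and of ones respectively. *)
Lemma sum_sparse_pair (tau : cell -> cell) (S : {set 'I_n}) :
  diag_symmetry tau ->
  EE (fun G => \sum_(A : {set 'I_n}) \sum_(B : {set 'I_n})
        (sparse_pair (rel_of tau G) S A B)%:R) <=
  \sum_(2 <= k < n.+1 | (k.*2 <= #|S|.+1)%N) hall_term #|S| k.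
Proof.
move=> tauP; rewrite expect_sum; have /andP[p0 p1] := p01.
under eq_bigr => A _ do rewrite expect_sum.
pose F (A : {set 'I_n}) := \sum_(B : {set 'I_n}) EE (fun G => (sparse_pair (rel_of tau G) S A B)%:R).
pose ok k := (1 < k)%N && (k.*2 <= #|S|.+1)%N.
have F0 (A : {set 'I_n}) : ~~ (ok #|A| && (A \subset S)) -> F A = 0.
  move=> nok; apply: big1 => B _; rewrite (@eq_expect _ _ _ _ _ (fun=> 0)) ?expect_cst //.
  move=> G _; case: (boolP (sparse_pair _ _ _ _)) => // /and5P[AS _ c1 _ /andP[c2 _]].
  by move: nok; rewrite /ok AS c1 c2.
pose x k (A : {set 'I_n}) j := k%:R ^+ 2 * p ^+ 2 + (j \in A)%:R * (k%:R * p) : R.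
have FA (A : {set 'I_n}) : ok #|A| -> A \subset S -> F A <= ((1 - p) ^+ (#|S| - #|A|)) ^+ #|A| *
    (expR 1 * (#|A|%:R ^+ 2 * p * (n%:R * p + 1)) / #|A|.-1%:R) ^+ #|A|.-1.
  move=> /andP[c1 c2] AS.
  have x0 j : 0 <= x #|A| A j.
    by rewrite /x addr_ge0 ?mulr_ge0 ?exprn_ge0 // ?ltW.
  have step : F A <= ((1 - p) ^+ (#|S| - #|A|)) ^+ #|A| *
      \sum_(B : {set 'I_n} | #|B| == #|A|.-1) \prod_(j in B) x #|A| A j.
    rewrite mulr_sumr [leRHS]big_mkcond /=; apply: ler_sum => B _.
    have Pge0 : 0 <= ((1 - p) ^+ (#|S| - #|A|)) ^+ #|A| * \prod_(j in B) x #|A| A j.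
      by rewrite mulr_ge0 ?prodr_ge0 // !exprn_ge0 // subr_ge0.
    have [/andP[BS cB]|nB] := boolP ((B \subset S) && (#|B|.+1 == #|A|)).
      by rewrite -(eqP cB) eqxx (eqP cB); apply: expect_sparse_pair; rewrite ?(eqP cB).
    rewrite (@eq_expect _ _ _ _ _ (fun=> 0)) ?expect_cst //; first by case: ifP.
    move=> G _; case: (boolP (sparse_pair _ _ _ _)) => // /and5P[_ BS _ cB _].
    by move: nB; rewrite BS cB.
  apply: (le_trans step); rewrite ler_wpM2l ?exprn_ge0 ?subr_ge0 //.
  apply: sum_prod_card_le => //.
  - rewrite /x big_split /= sumr_const card_ord -mulr_suml.
    rewrite (_ : \sum_j (j \in A)%:R = #|A|%:R); last first.
      by rewrite -sum1_card natr_sum [RHS]big_mkcond /=; apply: eq_bigr => j _; case: (j \in A).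
    rewrite -mulr_natl.
    rewrite le_eqVlt; apply/orP; left; apply/eqP; ring.
  - have cA0 : 0 < #|A|%:R :> R by rewrite ltr0n; apply: ltn_trans c1.
    by rewrite !mulr_gt0 // ltr_pwDr // mulr_ge0 // ltW.
  - by move: c1; case: #|A| => [|[]].
rewrite (_ : \sum_(A : {set 'I_n}) _ = \sum_(A : {set 'I_n}) F A) //.
rewrite (partition_big (fun A : {set 'I_n} => inord #|A| : 'I_n.+1) xpredT) //=.
rewrite (@big_nat_widenl _ _ _ 2 0) // [leRHS]big_mkcond /= big_mkord; apply: ler_sum => k _.
have cardE (A : {set 'I_n}) : ((inord #|A| : 'I_n.+1) == k) = (#|A| == k).
  by rewrite -val_eqE /= inordK // ltnS -[X in (_ <= X)%N]card_ord max_card.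
under eq_bigl => A do rewrite cardE.
rewrite andbC -/(ok k); case: ifP => okk; last first.
  by rewrite big1 // => A /eqP cA; apply: F0; rewrite cA okk.
set c := ((1 - p) ^+ (#|S| - k)) ^+ k *
    (expR 1 * (k%:R ^+ 2 * p * (n%:R * p + 1)) / k.-1%:R) ^+ k.-1.
have c0 : 0 <= c.
  rewrite /c mulr_ge0 ?exprn_ge0 ?subr_ge0 // !mulr_ge0 ?expR_ge0 ?invr_ge0 //.
    exact: ltW.
  by rewrite addr_ge0 // mulr_ge0 // ltW.
apply: (@le_trans _ _ (\sum_(A : {set 'I_n} | #|A| == k) c)).
  apply: ler_sum => A /eqP cA; have [AS|AS] := boolP (A \subset S).
    by have := FA A; rewrite cA => /(_ okk AS).
  by rewrite F0 // cA negb_and AS orbT.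
rewrite (_ : \sum_(A : {set 'I_n} | #|A| == k) c =
    c * \sum_(A : {set 'I_n} | #|A| == k) \prod_(j in A) 1); last first.
  by rewrite mulr_sumr; apply: eq_bigr => A _; rewrite big1 ?mulr1.
rewrite /hall_term -mulrA [X in _ <= _ * X]mulrC -/c mulrC ler_wpM2r //.
have k0 : (0 < k)%N by case/andP: okk; case: (nat_of_ord k).
apply: sum_prod_card_le => //.
  by rewrite sumr_const card_ord.
by rewrite ltr0n; apply: leq_trans k0 _; rewrite -ltnS.
Qed.

(** Harris' inequality for the rows against the columns, minus a union bound over
    sparse pairs of rows and of columns. *)
Lemma cycle_cover_prob (S : {set 'I_n}) :
  (1 - (1 - q) * (1 - p) ^+ #|S|.-1) ^+ (2 * #|S|)
    - 2 * \sum_(2 <= k < n.+1 | (k.*2 <= #|S|.+1)%N) hall_term #|S| k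
  <= EE (fun G => (cycle_cover (rel_of id G) S)%:R).
Proof.
pose hits tau (G : {set cell}) : R := \prod_(i in S) (hit tau i S G)%:R.
pose bad tau (G : {set cell}) : R := \sum_(A : {set 'I_n}) \sum_(B : {set 'I_n})
        (sparse_pair (rel_of tau G) S A B)%:R.
have bad0 tau G : 0 <= bad tau G.
  by apply: sumr_ge0 => A _; apply: sumr_ge0 => B _; rewrite ler0n.
have bad1 tau G A B : sparse_pair (rel_of tau G) S A B -> 1 <= bad tau G.
  move=> sp; rewrite /bad (bigD1 A) //= (bigD1 B) //= sp -addrA lerDl addr_ge0 //.
    by apply: sumr_ge0 => *; rewrite ler0n.
  by apply: sumr_ge0 => *; apply: sumr_ge0 => *; rewrite ler0n.
have hits01 tau G : 0 <= hits tau G <= 1.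
  rewrite prodr_ge0 /=; last by move=> *; rewrite ler0n.
  by apply: prodr_ile1 => i _; rewrite ler0n lern1 leq_b1.
have pt (G : {set cell}) : hits id G * hits swap G - (bad id G + bad swap G)
    <= (cycle_cover (rel_of id G) S)%:R.
  have /andP[h0 h1] := hits01 id G; have /andP[h0' h1'] := hits01 swap G.
  have b0 := bad0 id G; have b0' := bad0 swap G.
  have le1 : hits id G * hits swap G <= 1 by rewrite mulr_ile1.
  case: (boolP (cycle_cover _ _)) => [_|nc].
    by rewrite lerBlDr ler_wpDr // addr_ge0.
  rewrite subr_le0.
  have [/forall_inP row|nrow] := boolP [forall i in S, hit id i S G]; last first.
    have [i iS nhit] : exists2 i, i \in S & ~~ hit id i S G.
      by apply/exists_inP; rewrite -negb_forall_in.
    by rewrite /hits (bigD1 i) //= (negPf nhit) !mul0r addr_ge0.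
  have [/forall_inP col|ncol] := boolP [forall i in S, hit swap i S G]; last first.
    have [i iS nhit] : exists2 i, i \in S & ~~ hit swap i S G.
      by apply/exists_inP; rewrite -negb_forall_in.
    by rewrite [hits swap _]/hits (bigD1 i) //= (negPf nhit) mul0r mulr0 addr_ge0.
  apply: (le_trans le1).
  have [||[A [B sp]]|[A [B sp]]] := @cycle_coverN_sparse_pair _ (rel_of id G) S _ _ nc.
  - by move=> i iS; have /exists_inP[j jS ij] := row i iS; exists j.
  - by move=> i iS; have /exists_inP[j jS ij] := col i iS; exists j.
  - by rewrite ler_wpDr // (bad1 id G A B).
  - by rewrite ler_wpDl // (bad1 swap G A B).
apply: le_trans (le_expect (edge_prob01 p01' q01) _ pt).
rewrite expectB expectD lerB //; last first.
  rewrite mulr_natl mulr2n lerD //; apply: sum_sparse_pair.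
    exact: diag_symmetry_id.
  exact: diag_symmetry_swap.
have inc tau : increasing_in (hits tau).
  move=> G G' GG'; apply: ler_prod => i _; rewrite ler0n.
  exact: increasing_hit.
apply: le_trans (harris (edge_prob01 p01' q01) _ (inc _) (inc _)).
have rowcol tau : diag_symmetry tau ->
    (1 - (1 - q) * (1 - p) ^+ #|S|.-1) ^+ #|S| <= EE (hits tau).
  by move=> tauP; apply: expect_all_hit.
rewrite mul2n -addnn exprD.
have b0 : 0 <= (1 - (1 - q) * (1 - p) ^+ #|S|.-1) ^+ #|S|.
  have /andP[q0 q1] := q01; have /andP[p0 p1] := p01'.
  rewrite exprn_ge0 // subr_ge0 mulr_ile1 ?subr_ge0 ?exprn_ge0 ?exprn_ile1 ?subr_ge0 ?gerBl //.
by rewrite ler_pM // rowcol //; [exact: diag_symmetry_id|exact: diag_symmetry_swap].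
Qed.

End CoverProbability.

(** * Probability of structural diagonalizability *)

Section DiagonalizableProbability.
Variables (R : realType) (n : nat) (p q : R).
Hypotheses (p01 : 0 <= p <= 1) (q01 : 0 <= q <= 1).
Local Notation cell := ('I_n * 'I_n)%type.
Local Notation w := (@edge_prob R n p q).
Local Notation EE := (expect w [set: cell]).
Local Notation swap := (fun e : cell => (e.2, e.1)).
Implicit Types (tau : cell -> cell) (G : {set cell}) (S Z : {set 'I_n}).

(** A cycle cover of the complement of [Z] gives every line outside [Z] an edge, so
    [Z] is then exactly the set of null lines. *)
Definition null_cover tau Z G : bool :=
  [forall i in Z, ~~ hit tau i [set: 'I_n] G] && cycle_cover (rel_of id G) (~: Z).

Lemma insensitive_cycle_cover S e : ~~ ((e.1 \in S) && (e.2 \in S)) ->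
  insensitive e (fun G => (cycle_cover (rel_of id G) S)%:R : R).
Proof.
move=> eS G; congr (_%:R); congr nat_of_bool; apply/existsP/existsP;
  move=> [s /andP[sS /forall_inP Gs]]; exists s; rewrite sS; apply/forall_inP => i iS;
  have := Gs i iS; rewrite /rel_of !inE //.
  case: eqP => //= ei; move: eS; rewrite -ei /= iS.
  by rewrite (perm_closed _ sS) iS.
by move=> ->; rewrite orbT.
Qed.

Lemma expect_null_cover tau Z :
  diag_symmetry tau -> (forall e, e.1 \in Z -> ((tau e).1 \in Z) || ((tau e).2 \in Z)) ->
  EE (fun G => (null_cover tau Z G)%:R) =
  ((1 - q) * (1 - p) ^+ n.-1) ^+ #|Z| * EE (fun G => (cycle_cover (rel_of id G) (~: Z))%:R).
Proof.
move=> tauP tauZ.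
pose absent G : R := \prod_(e in finset.setX Z [set: 'I_n]) (tau e \notin G)%:R.
have -> : EE (fun G => (null_cover tau Z G)%:R) =
    EE (fun G => absent G * (cycle_cover (rel_of id G) (~: Z))%:R).
  apply: eq_expect => G _; rewrite /null_cover -mulnb natrM; congr (_ * _).
  have [/forall_inP nohit|] := boolP [forall i in Z, ~~ hit tau i [set: 'I_n] G].
    rewrite /absent big1 // => -[i j]; rewrite finset.in_setX => /andP[iZ jT].
    have := nohit i iZ; rewrite negb_exists_in => /forall_inP/(_ j jT) ->.
    by [].
  rewrite negb_forall_in => /exists_inP[i iZ]; rewrite negbK => /exists_inP[j jT ij].
  by rewrite /absent (bigD1 (i, j)) ?finset.in_setX ?iZ ?jT //= ij mul0r.
rewrite expect_indep; last first.
  move=> e; have [/exists_inP[e' e'Z /eqP->]|/exists_inPn nex] :=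
     boolP [exists e' in finset.setX Z [set: 'I_n], e == tau e'].
    right; apply: insensitive_cycle_cover; rewrite !inE -negb_or negbK.
    by apply: tauZ; move: e'Z; rewrite !inE andbT.
  left; apply: insensitive_prod => e' /nex ne.
  exact: (insensitive_mem (fun b => (~~ b)%:R)).
congr (_ * _); rewrite expect_absent // prod_setX -prodr_const.
apply: eq_bigr => i iZ; rewrite prod_row_in ?inE //.
by rewrite cardsT card_ord.
Qed.

Lemma expect_isolated i :
  EE (fun G => (~~ hit id i [set: 'I_n] G)%:R * (~~ hit swap i [set: 'I_n] G)%:R)
   <= (1 - p) ^+ n.-1 * (1 - p) ^+ n.-1.
Proof.
pose C := finset.setX [set i] ([set: 'I_n] :\ i).
pose absent tau G : R := \prod_(e in C) (tau e \notin G)%:R.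
have absentE tau : diag_symmetry tau -> EE (absent tau) = (1 - p) ^+ n.-1.
  move=> tauP; rewrite expect_absent // prod_setX big_set1 (eq_bigr (fun=> 1 - p)).
    rewrite prodr_const; congr (_ ^+ _).
    have : #|[set: 'I_n]| = n by rewrite cardsT card_ord.
    have := cardsD1 i [set: 'I_n]; rewrite finset.in_setT add1n => -> cn.
    exact: (congr1 predn cn).
  by move=> j; rewrite !inE andbT /edge_prob /= eq_sym => /negPf->.
rewrite -{1}(absentE id (@diag_symmetry_id n)) -(absentE swap (@diag_symmetry_swap n)).
rewrite -expect_indep; last first.
  move=> e; have [eC|eC] := boolP (e \in C).
    right; apply: insensitive_prod => e' e'C.
    apply: (insensitive_mem (fun b => (~~ b)%:R)).
    move: eC e'C; rewrite !inE !andbT => /andP[/eqP e1 _] /andP[_ ni].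
    by apply: contraNneq ni => Ee; rewrite -e1 Ee.
  left; apply: insensitive_prod => e' e'C.
  apply: (insensitive_mem (fun b => (~~ b)%:R)).
  by apply: contraNneq eC => ->.
apply: le_expect => // [e|G]; first exact: edge_prob01.
have le tau : (~~ hit tau i [set: 'I_n] G)%:R <= absent tau G.
  case: (boolP (hit _ _ _ _)) => [_|nh] /=; first by apply: prodr_ge0 => *; rewrite ler0n.
  rewrite /absent big1 // => -[i' j]; rewrite !inE => /andP[/eqP /= -> _].
  by move: nh; rewrite negb_exists_in => /forall_inP/(_ j (finset.in_setT j)) ->.
by rewrite ler_pM ?ler0n.
Qed.

Lemma null_cover_diagonalizable tau Z G :
  tau = id \/ tau = swap -> null_cover tau Z G -> G \in structurally_diagonalizable_digraphs R n.
Proof.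
move=> tauE /andP[/forall_inP nohit /existsP[s /andP[sZ /forall_inP Gs]]].
rewrite inE; apply: (@structurally_diagonalizable_cover R n G Z s).
- by move=> i iZ; rewrite (out_perm sZ) // inE iZ.
- by move=> i iZ; apply: Gs; rewrite inE.
have absent i j : i \in Z -> tau (i, j) \notin G.
  move=> iZ; have := nohit i iZ; rewrite negb_exists_in => /forall_inP/(_ j (finset.in_setT j)).
  by [].
by case: tauE => Et; [left=> i j iZ|right=> j i iZ]; have := absent i j iZ; rewrite Et.
Qed.

Lemma null_coverE tau Z G :
  tau = id \/ tau = swap -> null_cover tau Z G -> Z = [set i | ~~ hit tau i [set: 'I_n] G].
Proof.
move=> tauE /andP[/forall_inP nohit /existsP[s /andP[sZ /forall_inP Gs]]].
apply/setP => i; rewrite inE; apply/idP/idP; first exact: nohit.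
apply: contraNT => iZ; case: tauE => ->.
  by apply/exists_inP; exists (s i); rewrite ?inE //; apply: Gs; rewrite inE.
apply/exists_inP; exists ((s^-1)%g i); rewrite ?inE //=.
have := Gs ((s^-1)%g i); rewrite /rel_of permKV; apply.
by rewrite -(perm_closed _ sZ) permKV inE.
Qed.

Lemma sum_null_cover_le1 tau G (P : pred {set 'I_n}) : tau = id \/ tau = swap ->
  \sum_(Z | P Z) (null_cover tau Z G)%:R <= 1 :> R.
Proof.
move=> tauE; pose Z0 := [set i | ~~ hit tau i [set: 'I_n] G].
apply: (@le_trans _ _ (\sum_(Z : {set 'I_n}) (null_cover tau Z G)%:R)).
  rewrite [leRHS](bigID P) /= lerDl; apply: sumr_ge0 => *; by rewrite ler0n.
rewrite (bigD1 Z0) //= big1 ?addr0; first by rewrite lern1 leq_b1.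
move=> Z /negPf ZZ0; case: (boolP (null_cover _ _ _)) => // /(null_coverE tauE).
by move/eqP; rewrite ZZ0.
Qed.

(** Each of the first two sums is at most one, as at most one [Z] qualifies.  When
    both are equal to one, a null column of the second cover has to be a null
    row of the first one, and the last sum counts such vertices. *)
Lemma indicator_diagonalizable_ge G :
  \sum_(Z : {set 'I_n} | (#|Z| < 3)%N) (null_cover id Z G)%:R +
  \sum_(Z : {set 'I_n} | (0 < #|Z| < 3)%N) (null_cover swap Z G)%:R -
  \sum_i (~~ hit id i [set: 'I_n] G)%:R * (~~ hit swap i [set: 'I_n] G)%:R
  <= (G \in structurally_diagonalizable_digraphs R n)%:R :> R.
Proof.
have corr0 : 0 <= \sum_i (~~ hit id i [set: 'I_n] G)%:R * (~~ hit swap i [set: 'I_n] G)%:R :> R.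
  by apply: sumr_ge0 => *; rewrite mulr_ge0 ?ler0n.
have idE : id = id :> (cell -> cell) \/ id = swap by left.
have swE : swap = id \/ swap = swap by right.
have le1 := sum_null_cover_le1 G (fun Z => #|Z| < 3)%N idE.
have le2 := sum_null_cover_le1 G (fun Z => 0 < #|Z| < 3)%N swE.
have [|noid] := boolP [exists Z : {set 'I_n}, null_cover id Z G]; last first.
  rewrite big1 ?add0r; last first.
    by move=> Z _; move: noid => /existsPn/(_ Z)/negPf->.
  have [/existsP[Z cZ]|nosw] := boolP [exists Z : {set 'I_n}, null_cover swap Z G].
    rewrite (null_cover_diagonalizable swE cZ) lerBlDr ler_wpDr //.
  rewrite big1 ?sub0r; last first.
    by move=> Z _; move: nosw => /existsPn/(_ Z)/negPf->.
  by apply: (@le_trans _ _ 0); rewrite ?oppr_le0 ?ler0n.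
case/existsP => Z cZ; rewrite (null_cover_diagonalizable idE cZ).
have [/existsP[Z' /andP[Z'0 cZ']]|nosw] :=
    boolP [exists Z : {set 'I_n}, (0 < #|Z|)%N && null_cover swap Z G]; last first.
  rewrite [X in _ + X - _]big1 ?addr0; first by rewrite lerBlDr ler_wpDr.
  move=> Z' /andP[Z'0 _]; move: nosw => /existsPn/(_ Z'); rewrite Z'0 /= => /negPf->.
  by [].
suff corr1 : 1 <= \sum_i (~~ hit id i [set: 'I_n] G)%:R * (~~ hit swap i [set: 'I_n] G)%:R :> R.
  by move: le1 le2 corr1 => /=; lra.
have [i iZ'] := card_gt0P Z'0.
have swi : ~~ hit swap i [set: 'I_n] G by move: iZ'; rewrite (null_coverE swE cZ') inE.
have idi : ~~ hit id i [set: 'I_n] G.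
  suff : i \in Z by rewrite (null_coverE idE cZ) inE.
  apply: contraNT swi => iZ.
  case/andP: cZ => _ /existsP[s /andP[sZ /forall_inP Gs]].
  apply/exists_inP; exists ((s^-1)%g i); rewrite ?inE //=.
  have := Gs ((s^-1)%g i); rewrite /rel_of permKV; apply.
  by rewrite -(perm_closed _ sZ) permKV inE.
rewrite (bigD1 i) //= swi idi mulr1 lerDl.
by apply: sumr_ge0 => *; rewrite mulr_ge0 ?ler0n.
Qed.

(** The expectation of the previous inequality; the 'C(n, k) sets of size k
    contribute a ^ k times a cycle cover probability each. *)
Lemma digraph_prob_diagonalizable_ge (a pi : R) :
  a = (1 - q) * (1 - p) ^+ n.-1 ->
  (forall S, (n <= #|S|.+2)%N -> pi <= EE (fun G => (cycle_cover (rel_of id G) S)%:R)) ->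
  pi * (1 + 2 * (n%:R * a) + 2 * ('C(n, 2)%:R * a ^+ 2))
    - n%:R * ((1 - p) ^+ n.-1 * (1 - p) ^+ n.-1)
  <= digraph_prob p q (structurally_diagonalizable_digraphs R n).
Proof.
move=> aE piP; rewrite digraph_probE.
apply: le_trans (le_expect (edge_prob01 p01 q01) _ indicator_diagonalizable_ge).
have a0 : 0 <= a.
  have /andP[p0 p1] := p01; have /andP[q0 q1] := q01.
  by rewrite aE mulr_ge0 ?exprn_ge0 ?subr_ge0.
rewrite expectB expectD lerB //; last first.
  rewrite expect_sum; apply: (@le_trans _ _ (\sum_(i < n) (1 - p) ^+ n.-1 * (1 - p) ^+ n.-1)).
    by apply: ler_sum => i _; apply: expect_isolated.
  by rewrite sumr_const card_ord -[leLHS]mulr_natl lexx.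
have layer tau k : diag_symmetry tau -> (k < 3)%N ->
    (forall Z e, e.1 \in Z -> ((tau e).1 \in Z) || ((tau e).2 \in Z)) ->
    pi * ('C(n, k)%:R * a ^+ k) <=
    \sum_(Z : {set 'I_n} | #|Z| == k) EE (fun G => (null_cover tau Z G)%:R).
  move=> tauP k3 tauZ.
  apply: (@le_trans _ _ (\sum_(Z : {set 'I_n} | #|Z| == k) pi * a ^+ k)).
    rewrite (eq_bigl (mem [set Z : {set 'I_n} | #|Z| == k])); last by move=> Z; rewrite !inE.
    rewrite sumr_const card_draws card_ord -[leRHS]mulr_natl.
    by rewrite [leRHS]mulrCA.
  apply: ler_sum => Z /eqP cZ; rewrite (expect_null_cover tauP (tauZ Z)) cZ -aE mulrC.
  rewrite ler_wpM2l ?exprn_ge0 // piP //.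
  by have := cardsC Z; rewrite card_ord cZ; lia.
have split3 (P : pred nat) (F : {set 'I_n} -> R) :
    \sum_(Z : {set 'I_n} | P #|Z| && (#|Z| < 3)%N) F Z =
    \sum_(k < 3 | P k) \sum_(Z : {set 'I_n} | #|Z| == k) F Z.
  rewrite (partition_big (fun Z : {set 'I_n} => inord #|Z| : 'I_3) (fun k : 'I_3 => P k)) /=.
    apply: eq_bigr => k Pk; apply: eq_bigl => Z; apply/andP/idP.
      by case=> /andP[_ Z3] /eqP <-; rewrite inordK.
    by move=> /eqP->; rewrite Pk ltn_ord /= -val_eqE /= inordK.
  by move=> Z /andP[PZ Z3]; rewrite inordK.
rewrite !expect_sum (split3 predT) (split3 (fun k => 0 < k)%N).
rewrite [X in _ <= _ + X]big_mkcond !big_ord_recl !big_ord0 /= add0r !addr0.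
have /= l0 := layer id 0 (@diag_symmetry_id n) isT (fun _ e h => introT orP (or_introl h)).
have /= l1 := layer id 1 (@diag_symmetry_id n) isT (fun _ e h => introT orP (or_introl h)).
have /= l2 := layer id 2 (@diag_symmetry_id n) isT (fun _ e h => introT orP (or_introl h)).
have /= l1' := layer swap 1 (@diag_symmetry_swap n) isT (fun _ e h => introT orP (or_intror h)).
have /= l2' := layer swap 2 (@diag_symmetry_swap n) isT (fun _ e h => introT orP (or_intror h)).
move: l0 l1 l1' l2 l2'; rewrite bin0 bin1 expr0 expr1 /bump /=.
lra.
Qed.

End DiagonalizableProbability.

(** * The expected number of sparse pairs *)

Section Estimates.
Variable R : realType.
Implicit Types (p q L : R).

(** The ratio of the geometric progression that dominates [hall_term], as a function
    of L = n p.  It tends to 0 when L goes to infinity, because the factor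
    exp (- L / 2) wins over the polynomial in L. *)
Definition hall_ratio L : R := 2 * expR 3 * (L + 1) ^+ 2 * expR (- (L / 2)).

Lemma expR_le_onem p k : p <= 1 -> (1 - p) ^+ k <= expR (- (p * k%:R)).
Proof.
move=> p1; rewrite -mulNr expRM_natr lerXn2r ?nnegrE ?subr_ge0 ?expR_ge0 //.
exact: expR_ge1Dx.
Qed.

(** By convexity of k ^ 2 on the range 2 <= k <= (n + 1) / 2, the exponent
    p k (m - k) is at least L + k L / 2 - k. *)
Lemma hall_term_le n m k p : 0 <= p -> p <= 1 / 5 -> (1 < k)%N -> (k.*2 <= m.+1)%N ->
  (m <= n)%N -> (n <= m.+2)%N ->
  hall_term n p m k <=
  expR 1 * n%:R * expR (- (n%:R * p)) * hall_ratio (n%:R * p) ^+ k.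
Proof.
move=> p0 p5 k1 km mn nm; set L := n%:R * p; set e : R := expR 1.
have L0 : 0 <= L by rewrite mulr_ge0.
have kR : 2 <= k%:R :> R by rewrite (ler_nat _ 2).
have k0 : 0 < k%:R :> R by lra.
have kP : k.-1%:R = k%:R - 1 :> R by rewrite -subn1 natrB // ltnW.
have e0 : 0 < e by rewrite expR_gt0.
have e_ge0 := ltW e0; have L1 : 0 <= L + 1 by rewrite addr_ge0.
have M1 : 1 <= 2 * e ^+ 2 * (L + 1) ^+ 2.
  have : 1 <= e ^+ 2 by rewrite exprn_ege1 // -(expR0 R) ler_expR.
  by nra.
have first : (e * n%:R / k%:R) ^+ k * (e * (k%:R ^+ 2 * p * (L + 1)) / k.-1%:R) ^+ k.-1
    <= e * n%:R * (2 * e ^+ 2 * (L + 1) ^+ 2) ^+ k.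
  have expk (x : R) : x ^+ k = x * x ^+ k.-1 by rewrite -exprS prednK // ltnW.
  rewrite (expk (e * n%:R / k%:R)) -mulrA -exprMn.
  apply: ler_pM; first by rewrite !mulr_ge0 ?invr_ge0.
  - by rewrite exprn_ge0 // !mulr_ge0 ?invr_ge0 ?exprn_ge0.
  - by rewrite ler_pdivrMr // ler_peMr ?mulr_ge0 //; lra.
  apply: (@le_trans _ _ ((2 * e ^+ 2 * (L + 1) ^+ 2) ^+ k.-1)); last first.
    by rewrite ler_weXn2l // leq_pred.
  rewrite lerXn2r ?nnegrE //.
  - by rewrite !mulr_ge0 ?invr_ge0 ?exprn_ge0.
  - by apply: le_trans M1.
  rewrite [leLHS](_ : _ = e ^+ 2 * L * (L + 1) * (k%:R / k.-1%:R)); last first.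
    by rewrite kP /L; field; rewrite !gt_eqF //; lra.
  have q2 : k%:R / k.-1%:R <= 2 :> R by rewrite kP ler_pdivrMr; lra.
  have -> : 2 * e ^+ 2 * (L + 1) ^+ 2 = e ^+ 2 * (L + 1) * (L + 1) * 2 by ring.
  have z0 : 0 <= k%:R / k.-1%:R :> R by rewrite divr_ge0.
  have y0 : 0 <= e ^+ 2 * L * (L + 1) by rewrite !mulr_ge0 ?exprn_ge0.
  have yy : e ^+ 2 * L * (L + 1) <= e ^+ 2 * (L + 1) * (L + 1).
    by rewrite ler_wpM2r // ler_wpM2l ?exprn_ge0 //; lra.
  exact: ler_pM.
have second : ((1 - p) ^+ (m - k)) ^+ k <= expR (- L) * (expR 1 * expR (- (L / 2))) ^+ k.
  rewrite -exprM; apply: le_trans (expR_le_onem _ _) _; first by lra.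
  rewrite -expRD -expRM_natr -expRD ler_expR.
  rewrite natrM natrB; last by lia.
  have nm' : n%:R <= m%:R + 2 :> R by rewrite -natrD ler_nat addn2.
  have km' : 2 * k%:R <= n%:R + 1 :> R.
    by rewrite -natrM natr1 ler_nat; lia.
  (* (k - 2) (k - (n + 1) / 2) <= 0 *)
  have sq : k%:R ^+ 2 <= (2 + (n%:R + 1) / 2) * k%:R - (n%:R + 1) :> R by nra.
  have psq : p * k%:R ^+ 2 <= p * ((2 + (n%:R + 1) / 2) * k%:R - (n%:R + 1)) by rewrite ler_wpM2l.
  have pm : p * k%:R * n%:R <= p * k%:R * (m%:R + 2) by rewrite ler_wpM2l // mulr_ge0 // ltW.
  have pk : p * k%:R <= 1 / 5 * k%:R by rewrite ler_wpM2r // ltW.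
  by rewrite /L; nra.
have -> : hall_ratio L = (2 * e ^+ 2 * (L + 1) ^+ 2) * (expR 1 * expR (- (L / 2))).
  rewrite /hall_ratio /e (_ : 3 = 1 * 3%:R) ?mul1r // -{1}[3](mul1r) expRM_natr; ring.
rewrite [_ ^+ k]exprMn /hall_term -/L -/e.
rewrite (_ : e * n%:R * expR (- L) * _ = (e * n%:R * (2 * e ^+ 2 * (L + 1) ^+ 2) ^+ k) *
   (expR (- L) * (expR 1 * expR (- (L / 2))) ^+ k)); last by ring.
apply: ler_pM => //.
  by rewrite mulr_ge0 // exprn_ge0 // !mulr_ge0 ?invr_ge0 ?exprn_ge0.
by rewrite !exprn_ge0 // subr_ge0; lra.
Qed.

Lemma geometric_tail_le (r : R) N : 0 <= r -> r <= 1 / 2 ->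
  \sum_(2 <= k < N) r ^+ k <= 2 * r ^+ 2.
Proof.
move=> r0 r2; have [N2|N2] := leqP N 2; first by rewrite big_geq // mulr_ge0 // exprn_ge0.
suff : \sum_(2 <= k < N) r ^+ k <= 2 * r ^+ 2 - 2 * r ^+ N.
  by move=> /le_trans; apply; rewrite gerBl mulr_ge0 // exprn_ge0.
elim: N N2 => // N IHN; rewrite ltnS leq_eqVlt => /predU1P[<-|N2].
  by rewrite big_nat1; nra.
rewrite big_nat_recr ?(ltnW N2) //=.
have := IHN N2; rewrite [r ^+ N.+1]exprS.
have : 0 <= (1 - 2 * r) * r ^+ N by rewrite mulr_ge0 ?exprn_ge0 //; lra.
lra.
Qed.

Lemma hall_sum_le n m p : 0 <= p -> p <= 1 / 5 -> (m <= n)%N -> (n <= m.+2)%N ->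
  hall_ratio (n%:R * p) <= 1 / 2 ->
  \sum_(2 <= k < n.+1 | (k.*2 <= m.+1)%N) hall_term n p m k <=
  expR 1 * n%:R * expR (- (n%:R * p)) * (2 * hall_ratio (n%:R * p) ^+ 2).
Proof.
move=> p0 p5 mn nm r2; set r := hall_ratio _; set c := expR 1 * _ * _.
have r0 : 0 <= r by rewrite /r /hall_ratio !mulr_ge0 ?expR_ge0 ?exprn_ge0 ?addr_ge0 ?mulr_ge0.
have c0 : 0 <= c by rewrite /c !mulr_ge0 ?expR_ge0.
apply: (@le_trans _ _ (\sum_(2 <= k < n.+1) c * r ^+ k)); last first.
  by rewrite -mulr_sumr ler_wpM2l // geometric_tail_le.
rewrite big_mkcond /= !big_nat; apply: ler_sum => k /andP[k2 _].
by case: ifP => [km|_]; [exact: hall_term_le | rewrite mulr_ge0 ?exprn_ge0].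
Qed.

End Estimates.

(** * Asymptotic rates at a fixed size *)

Section FixedSize.
Variable R : realType.

Lemma expR_le_1D (x d : R) : 0 <= d -> d <= 1 -> x <= d / 2 -> expR x <= 1 + d.
Proof.
move=> d0 d1 xd; apply: (@le_trans _ _ (expR (d / 2))); first by rewrite ler_expR.
have h := expR_ge1Dx (- (d / 2)); have hx := expR_gt0 (d / 2).
have : expR (d / 2) * (1 - d / 2) <= expR (d / 2) * expR (- (d / 2)).
  by rewrite ler_wpM2l // ltW.
rewrite -expRD subrr expR0 => h1.
rewrite -(ler_pM2r (_ : 0 < 1 - d / 2)); last by lra.
apply: (le_trans h1); clear -d0 d1; nra.
Qed.

Lemma onem_ge_expR (x : R) : 0 <= x -> x <= 1 / 2 -> expR (- (x + 2 * x ^+ 2)) <= 1 - x.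
Proof.
move=> x0 x2; have h := expR_ge1Dx (x + 2 * x ^+ 2).
have pos : 0 < 1 + (x + 2 * x ^+ 2) by nra.
apply: (@le_trans _ _ (1 + (x + 2 * x ^+ 2))^-1).
  by rewrite expRN lef_pV2 ?posrE ?expR_gt0.
rewrite invf_ple ?posrE //; last by lra.
rewrite -[leLHS]mul1r ler_pdivrMr; last by lra.
have : 0 <= x ^+ 2 * (1 - 2 * x) by rewrite mulr_ge0 ?exprn_ge0 //; lra.
by rewrite !expr2; nra.
Qed.

Section Rate.
Variables (n : nat) (p k eps d : R).
Local Notation N := (n%:R : R).
Hypotheses (p0 : 0 <= p) (pd : p <= d / 12) (Lpd : N * p * p <= d / 12).
(* the relation p = (ln n + c + eps) / n, with k = exp (- c) *)
Hypotheses (NL : N * expR (- (N * p)) = k * expR (- eps)).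
Hypotheses (eps1 : eps <= d / 4) (eps2 : - eps <= d / 4).
Hypotheses (k0 : 0 <= k) (d0 : 0 <= d) (d2 : d <= 1 / 2).

Lemma null_row_rate_ge : k * (1 - d) <= N * (1 - p) ^+ n.-1.
Proof.
move: (p0) (pd) (Lpd) (eps1) (eps2) (d0) (d2) => p0' pd' Lpd' eps1' eps2' d0' d2'.
have p2 : p <= 1 / 2 by lra.
apply: (@le_trans _ _ (N * expR (- (p + 2 * p ^+ 2)) ^+ n)); last first.
  rewrite ler_wpM2l //; apply: (@le_trans _ _ ((1 - p) ^+ n)).
    by rewrite lerXn2r ?nnegrE ?expR_ge0 ?onem_ge_expR //; lra.
  by rewrite ler_wiXn2l ?leq_pred //; lra.
rewrite -expRM_natr.
have -> : - (p + 2 * p ^+ 2) * N = - (N * p) + - (2 * (N * p * p)) by ring.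
rewrite expRD mulrA NL -mulrA -expRD ler_wpM2l //.
by apply: le_trans (expR_ge1Dx _); lra.
Qed.

Lemma rate_le m : (n <= m + 3)%N -> N * (1 - p) ^+ m <= k * (1 + d).
Proof.
move: (p0) (pd) (Lpd) (eps1) (eps2) (d0) (d2) => p0' pd' Lpd' eps1' eps2' d0' d2'.
move=> nm; have p1 : p <= 1 by lra.
apply: (@le_trans _ _ (N * expR (- (N * p) + 3 * p))).
  rewrite ler_wpM2l //; apply: le_trans (expR_le_onem _ p1) _; rewrite ler_expR.
  have hN : N <= m%:R + 3 by rewrite -natrD ler_nat.
  have : p * N <= p * (m%:R + 3) by rewrite ler_wpM2l.
  by lra.
rewrite expRD mulrA NL -mulrA -expRD ler_wpM2l //.
by apply: expR_le_1D; lra.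
Qed.

Lemma nonnull_lines_ge s m : 0 <= s -> s <= 1 -> (0 < n)%N -> (m <= n)%N -> (n <= m.+2)%N ->
  2 * k <= d * N ->
  expR (- (2 * (s * k))) * (1 - 8 * k * d) <= (1 - s * (1 - p) ^+ m.-1) ^+ (2 * m).
Proof.
move: (p0) (pd) (Lpd) (eps1) (eps2) (d0) (d2) => p0' pd' Lpd' eps1' eps2' d0' d2'.
move=> s0 s1 n0 mn nm kN; have N0 : 0 < N by rewrite ltr0n.
set b := s * (1 - p) ^+ m.-1; have p1 : 0 <= 1 - p by lra.
have b0 : 0 <= b by rewrite mulr_ge0 ?exprn_ge0.
have rate : N * (1 - p) ^+ m.-1 <= k * (1 + d).
  by apply: rate_le; rewrite (leq_trans nm) // addn3 !ltnS leqSpred.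
(* an upper bound for b of order 1 / N that does not depend on m *)
pose b' := s * k * (1 + d) / N.
have Nb' : N * b' = s * k * (1 + d) by rewrite /b' mulrC divfK // gt_eqF.
have sk0 : 0 <= s * k by rewrite mulr_ge0.
have b'0 : 0 <= b' by rewrite divr_ge0 // mulr_ge0 //; lra.
have bb' : b <= b'.
  rewrite -(ler_pM2l N0) Nb' /b mulrCA -mulrA ler_wpM2l //.
have b'd : b' <= d.
  rewrite /b' ler_pdivrMr //; apply: le_trans kN.
  have : s * k * (1 + d) <= 1 * k * 2.
    by apply: ler_pM; rewrite ?ler_wpM2r ?mulr_ge0 //; lra.
  by lra.
apply: (@le_trans _ _ ((1 - b') ^+ (2 * n))); last first.
  apply: (@le_trans _ _ ((1 - b') ^+ (2 * m))).
    by rewrite ler_wiXn2l ?leq_mul2l //; lra.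
  by rewrite lerXn2r ?nnegrE //; lra.
apply: (@le_trans _ _ (expR (- (b' + 2 * b' ^+ 2)) ^+ (2 * n))); last first.
  by rewrite lerXn2r ?nnegrE ?expR_ge0 ?onem_ge_expR //; lra.
rewrite -expRM_natr natrM.
have -> : - (b' + 2 * b' ^+ 2) * (2 * N) = - (2 * (N * b' * (1 + 2 * b'))) by ring.
rewrite Nb'.
apply: (@le_trans _ _ (expR (- (2 * (s * k)) + - (8 * k * d)))).
  by rewrite expRD ler_wpM2l ?expR_ge0 // expR_ge1Dx.
rewrite ler_expR.
have h1 : s * k * (1 + d) * (1 + 2 * b') <= s * k * ((1 + d) * (1 + 2 * d)).
  by rewrite -mulrA ler_wpM2l // ler_wpM2l //; lra.
have h2 : s * k * d <= k * d by rewrite ler_wpM2r // ler_piMl.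
have h3 : (1 + d) * (1 + 2 * d) <= 1 + 4 * d.
  have : d * d <= 1 / 2 * d by rewrite ler_wpM2r.
  by lra.
have h4 : s * k * ((1 + d) * (1 + 2 * d)) <= s * k * (1 + 4 * d) by rewrite ler_wpM2l.
by lra.
Qed.

End Rate.

(** Here u stands for exp (- 2 s k) and y for the expected number of null rows, which
    is at least s k up to a relative error d; all the losses are of order d. *)
Lemma poisson_weight_arith (u k s d y N : R) :
  0 <= u -> u * (1 + s * k) ^+ 2 <= 1 -> 0 <= k -> 0 <= s -> s <= 1 ->
  0 <= d -> d <= 1 / 2 -> 8 * k * d <= 1 -> 0 < N -> 1 <= d * N -> 1 <= N ->
  s * k * (1 - d) <= y -> y <= 2 * k ->
  u * (1 + s * k) ^+ 2 - d * (8 * k + 3 + (1 + 2 * k) ^+ 2) <=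
  (u * (1 - 8 * k * d) - d) * (1 + 2 * y + y ^+ 2 * (1 - 1 / N)).
Proof.
move=> u0 v1 k0 s0 s1 d0 d2 kd N0 dN N1 y_ge y_le.
set lam := s * k in v1 y_ge *.
have lam0 : 0 <= lam by rewrite mulr_ge0.
have y0 : 0 <= y by apply: le_trans y_ge; rewrite mulr_ge0 //; lra.
set i := 1 / N; have i0 : 0 <= i by rewrite divr_ge0 // ltW.
have id : i <= d by rewrite ler_pdivrMr.
have i1 : i <= 1 by rewrite ler_pdivrMr // mul1r.
clearbody i; clear N0 dN N1.
set Q := 1 + 2 * y + y ^+ 2 * (1 - i).
have y2 : 0 <= y ^+ 2 by rewrite exprn_ge0.
have Q_le : Q <= (1 + 2 * k) ^+ 2.
  have h1 : y ^+ 2 * (1 - i) <= y ^+ 2 by rewrite ler_piMr //; lra.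
  have h2 : y ^+ 2 <= (2 * k) ^+ 2 by rewrite lerXn2r ?nnegrE //; lra.
  by rewrite /Q; clear -h1 h2 y_le; lra.
have Q0 : 0 <= Q by rewrite /Q !addr_ge0 ?mulr_ge0 //; lra.
have Q_ge : (1 - 3 * d) * (1 + lam) ^+ 2 <= Q.
  have ysq : (lam * (1 - d)) ^+ 2 <= y ^+ 2.
    by rewrite lerXn2r ?nnegrE //; rewrite mulr_ge0 //; lra.
  have h1 : (lam * (1 - d)) ^+ 2 * (1 - d) <= y ^+ 2 * (1 - i).
    by apply: ler_pM => //; rewrite ?exprn_ge0 ?mulr_ge0 //; lra.
  have h2 : 1 - 3 * d <= (1 - d) ^+ 2 * (1 - d).
    have : 0 <= d ^+ 2 * (3 - d) by rewrite mulr_ge0 ?exprn_ge0 //; lra.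
    by clear; lra.
  have h3 : lam ^+ 2 * (1 - 3 * d) <= lam ^+ 2 * ((1 - d) ^+ 2 * (1 - d)).
    by rewrite ler_wpM2l ?exprn_ge0.
  have h4 : 0 <= lam * d by rewrite mulr_ge0.
  rewrite /Q; clear -h1 h3 h4 y_ge d0; lra.
clearbody Q; have v0 : 0 <= u * (1 + lam) ^+ 2 by rewrite mulr_ge0 ?exprn_ge0 //; lra.
have kd0 : 0 <= 1 - 8 * k * d by lra.
have uQ : (1 - 8 * k * d) * ((1 - 3 * d) * (u * (1 + lam) ^+ 2)) <= u * (1 - 8 * k * d) * Q.
  have -> : (1 - 8 * k * d) * ((1 - 3 * d) * (u * (1 + lam) ^+ 2)) =
     u * (1 - 8 * k * d) * ((1 - 3 * d) * (1 + lam) ^+ 2) by ring.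
  by rewrite ler_wpM2l // mulr_ge0.
set v := u * (1 + lam) ^+ 2 in v0 v1 uQ *; clearbody v.
have dQ : d * Q <= d * (1 + 2 * k) ^+ 2 by rewrite ler_wpM2l.
have loss : v - (8 * k + 3) * d <= (1 - 8 * k * d) * ((1 - 3 * d) * v).
  have h1 : 0 <= k * d * d * v by rewrite !mulr_ge0.
  have h2 : (8 * k + 3) * d * v <= (8 * k + 3) * d.
    by rewrite ler_piMr // mulr_ge0 //; lra.
  by clear -h1 h2; lra.
by rewrite mulrBl; clear -uQ dQ loss; lra.
Qed.

End FixedSize.

(** If (L + 1) ^ 2 exp (- L / 2) is at most d / tolerance k, then each of the error
    terms in p, 1 / n and [hall_ratio] is at most a fixed fraction of d; there
    is one summand for each error term. *)
Definition tolerance (R : realType) (k : R) : R :=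
  24 / k + 4 + 8 * k + 16 * (expR 1 * expR 3) * k + 4 * expR 3.

Lemma tolerance_bounds (R : realType) (k eta d : R) :
  0 < k -> 0 <= eta -> eta * tolerance k = d ->
  [/\ 24 * eta <= d * k, 4 * eta <= d, 8 * k * eta <= d,
      16 * (expR 1 * expR 3) * k * eta <= d & 4 * expR 3 * eta <= d].
Proof.
move=> k0 eta0 etad.
have e1 : 0 <= expR 1 :> R by rewrite expR_ge0.
have e3 : 0 <= expR 3 :> R by rewrite expR_ge0.
have t1 : 0 <= eta * (24 / k) by rewrite mulr_ge0 ?divr_ge0 // ltW.
have t2 : 0 <= eta * k by rewrite mulr_ge0 // ltW.
have t3 : 0 <= eta * expR 3 by rewrite mulr_ge0.
have t4 : 0 <= eta * k * (expR 1 * expR 3) by rewrite !mulr_ge0 // ltW.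
have E : eta * (24 / k) + 4 * eta + 8 * (eta * k) + 16 * (eta * k * (expR 1 * expR 3))
   + 4 * (eta * expR 3) = d by rewrite -etad /tolerance; ring.
have h : 24 * eta <= d * k.
  by rewrite -ler_pdivrMr // (_ : 24 * eta / k = eta * (24 / k)); [lra | ring].
by split; lra.
Qed.

(** All the bounds compare N with (L + 1) ^ 2, through
    N = k exp (- eps) exp L. *)
Lemma size_bounds (R : realType) (k L eps eta d N : R) :
  0 < k -> 0 < N -> 1 <= L -> 0 < d -> d <= 1 / 2 -> eps <= d / 4 -> 0 <= eta ->
  N * expR (- L) = k * expR (- eps) ->
  (L + 1) ^+ 2 * expR (- (L / 2)) <= eta ->
  24 * eta <= d * k -> 4 * eta <= d -> 8 * k * eta <= d ->
  [/\ L / N <= d / 12, L * (L / N) <= d / 12, 1 <= d * N, 2 * k <= d * N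
    & 4 * k ^+ 2 <= d * N].
Proof.
move=> k0 N0 L1 d0 d2 epsd eta0 NL weta eta24 eta4 eta8.
have expeps : expR eps <= 2 by apply: le_trans (_ : 1 + d <= _); [apply: expR_le_1D|]; lra.
have sq0 : 0 <= (L + 1) ^+ 2 by rewrite exprn_ge0 //; lra.
have kN : k * (L + 1) ^+ 2 <= 2 * eta * N.
  have E : k = N * expR (- L) * expR eps by rewrite NL -mulrA -expRD addNr expR0 mulr1.
  have eL : expR (- L) <= expR (- (L / 2)) by rewrite ler_expR; lra.
  have h : expR (- L) * (L + 1) ^+ 2 <= eta.
    by apply: le_trans weta; rewrite mulrC ler_wpM2l.
  rewrite {1}E.
  have -> : N * expR (- L) * expR eps * (L + 1) ^+ 2 =
     expR eps * (expR (- L) * (L + 1) ^+ 2) * N by ring.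
  have h2 : expR eps * (expR (- L) * (L + 1) ^+ 2) <= 2 * eta.
    by apply: ler_pM => //; rewrite mulr_ge0 // expR_ge0.
  by rewrite ler_wpM2r // ltW.
have Nd : (L + 1) ^+ 2 <= d / 12 * N.
  rewrite -(ler_pM2l k0); apply: (le_trans kN).
  rewrite (_ : k * (d / 12 * N) = (d * k) / 12 * N); last by ring.
  have h : 2 * eta <= d * k / 12 by lra.
  by rewrite ler_wpM2r // ltW.
have L1sq : L + 1 <= (L + 1) ^+ 2 by rewrite expr2 ler_peMl //; lra.
have LLsq : L * L <= (L + 1) ^+ 2.
  by rewrite expr2; apply: ler_pM; lra.
have kk : k <= 2 * eta * N by apply: le_trans kN; rewrite ler_peMr ?(ltW k0) //; lra.
have dN0 : 0 <= d * N by rewrite mulr_ge0 // ltW.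
have h4 : 4 * eta * N <= d * N by rewrite ler_wpM2r // ltW.
have h8 : 8 * k * eta * N <= d * N by rewrite ler_wpM2r // ltW.
have kkk : k * k <= k * (2 * eta * N) by rewrite ler_wpM2l // ltW.
split; rewrite ?mulrA ?ler_pdivrMr //; lra.
Qed.

(** The lower bound for a given number of vertices, with an error proportional to
    the accuracy [d]. *)
Lemma digraph_prob_fixed_size (R : realType) (c q eps d eta : R) (n : nat) :
  let k := expR (- c) in let L := ln n%:R + c + eps in let p := L / n%:R in
  (0 < n)%N -> 0 <= q <= 1 -> 0 < d -> d <= 1 / 2 -> 8 * k * d <= 1 ->
  `|eps| <= d / 4 -> 1 <= L ->
  (L + 1) ^+ 2 * expR (- (L / 2)) <= eta -> eta * tolerance k = d ->
  - (d * (8 * k + 4 + (1 + 2 * k) ^+ 2)) <=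
  digraph_prob p q (structurally_diagonalizable_digraphs R n)
     - expR (- (2 * (1 - q) * k)) *
       (1 + 2 * (1 - q) * k + (1 - q) ^+ 2 * expR (- (2 * c))).
Proof.
move=> k L p n0 q01; have /andP[q0 q1] := q01; move=> d0 d2 kd epsd L1 weta etad.
set N : R := n%:R; have N0 : 0 < N by rewrite ltr0n.
have k0 : 0 < k by rewrite expR_gt0.
have eta0 : 0 <= eta.
  by apply: le_trans weta; rewrite mulr_ge0 ?expR_ge0 ?exprn_ge0 //; lra.
have [eps1 eps2] : eps <= d / 4 /\ - eps <= d / 4.
  by move: epsd; rewrite ler_norml => /andP[? ?]; split=> //; rewrite lerNl.
have [eta24 eta4 eta8 eta16 etae] := tolerance_bounds k0 eta0 etad.
have NL : N * expR (- L) = k * expR (- eps).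
  have -> : - L = - ln N + (- c - eps) by rewrite /L /N; ring.
  by rewrite expRD [expR (- ln N)]expRN lnK ?posrE // mulrA divff ?gt_eqF // mul1r expRD.
have [pd Lpd dN kNd kkNd] := size_bounds k0 N0 L1 d0 d2 eps1 eta0 NL weta eta24 eta4 eta8.
rewrite -/p in pd Lpd.
have pN : N * p = L by rewrite /p mulrC divfK // gt_eqF.
have p0 : 0 < p by rewrite divr_gt0 //; lra.
have p1 : p <= 1 by lra.
have p5 : p <= 1 / 5 by lra.
have p01 : 0 < p <= 1 by rewrite p0.
have p01' : 0 <= p <= 1 by rewrite ltW.
clearbody L p; subst L; clear etad.
have k0' := ltW k0; have d0' := ltW d0; have p0' := ltW p0; have N0' := ltW N0.
set s := 1 - q; have s0 : 0 <= s by rewrite subr_ge0.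
have s1 : s <= 1 by rewrite gerBl.
have onep0 : 0 <= 1 - p by rewrite subr_ge0.
set rho := N * (1 - p) ^+ n.-1.
have rho_ge : k * (1 - d) <= rho := null_row_rate_ge p0' pd Lpd NL eps1 eps2 k0' d0' d2.
have rho_le : rho <= k * (1 + d).
  by apply: (rate_le p0' pd Lpd NL eps1 eps2 k0' d0' d2); rewrite addn3 (leq_trans (leqSpred n)) // ltnS ltnW.
have rho0 : 0 <= rho by rewrite mulr_ge0 ?exprn_ge0.
have rho2k : rho <= 2 * k.
  apply: (le_trans rho_le); rewrite mulrC ler_wpM2r //; clear -d2; lra.
set u := expR (- (2 * (s * k))).
have u0 : 0 <= u by rewrite expR_ge0.
pose pi := u * (1 - 8 * k * d) - d.
have piP (S : {set 'I_n}) : (n <= #|S|.+2)%N ->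
    pi <= expect (@edge_prob R n p q) finset.setT (fun G => (cycle_cover (rel_of id G) S)%:R).
  move=> nS; apply: le_trans (cycle_cover_prob p01 q01 S).
  have Sn : (#|S| <= n)%N by rewrite -[X in (_ <= X)%N]card_ord max_card.
  rewrite /pi lerB //.
    exact: (nonnull_lines_ge p0' pd Lpd NL eps1 eps2 k0' d0' d2 s0 s1 n0 Sn nS kNd).
  set r := hall_ratio (N * p).
  have rE : r <= 2 * expR 3 * eta.
    by rewrite /r /hall_ratio -mulrA ler_wpM2l // mulr_ge0 // expR_ge0.
  have r0 : 0 <= r.
    by rewrite /r /hall_ratio !mulr_ge0 ?expR_ge0 ?exprn_ge0 ?addr_ge0 ?mulr_ge0.
  have r2 : r <= 1 / 2 by clear -rE etae d2; lra.
  have hs := hall_sum_le p0' p5 Sn nS r2.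
  apply: (@le_trans _ _ (2 * (expR 1 * N * expR (- (N * p)) * (2 * r ^+ 2)))).
    by rewrite ler_wpM2l.
  have mu2 : N * expR (- (N * p)) <= 2 * k.
    rewrite NL mulrC ler_wpM2r //.
    have [d1 eps2'] : d <= 1 /\ - eps <= d / 2 by clear -eps2 d0 d2; split; lra.
    by apply: (le_trans (expR_le_1D d0' d1 eps2')); clear -d1; lra.
  have rr : r ^+ 2 <= 2 * expR 3 * eta.
    apply: le_trans rE; rewrite expr2 ler_piMl //; clear -r2; lra.
  have h1 : N * expR (- (N * p)) * r ^+ 2 <= 2 * k * (2 * expR 3 * eta).
    by apply: ler_pM => //; [rewrite mulr_ge0 // expR_ge0 | rewrite exprn_ge0].
  have h2 : expR 1 * (N * expR (- (N * p)) * r ^+ 2) <= expR 1 * (2 * k * (2 * expR 3 * eta)).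
    by rewrite ler_wpM2l // expR_ge0.
  clear -h2 eta16; lra.
set a := s * (1 - p) ^+ n.-1.
have := digraph_prob_diagonalizable_ge p01' q01 (erefl a) piP.
set P := digraph_prob _ _ _; set y := s * rho; rewrite -/N.
have Na : N * a = y by rewrite /y /rho /a mulrCA.
have binE : 2 * ('C(n, 2)%:R * a ^+ 2) = y ^+ 2 * (1 - 1 / N).
  have b2 : 2 * 'C(n, 2)%:R = N * (N - 1).
    by rewrite mulrC -natrM (bin_ffact n 2) /= ffactnS ffactn1 natrM -subn1 natrB.
  by rewrite mulrA b2 -Na; field; rewrite gt_eqF.
rewrite binE Na => lower.
have corr : N * ((1 - p) ^+ n.-1 * (1 - p) ^+ n.-1) <= d.
  have -> : N * ((1 - p) ^+ n.-1 * (1 - p) ^+ n.-1) = rho ^+ 2 / N.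
    by rewrite /rho; field; rewrite gt_eqF.
  rewrite ler_pdivrMr //; apply: le_trans kkNd.
  have -> : 4 * k ^+ 2 = (2 * k) ^+ 2 by ring.
  by rewrite lerXn2r ?nnegrE // mulr_ge0.
have v1 : u * (1 + s * k) ^+ 2 <= 1.
  have sk0 : 0 <= s * k by rewrite mulr_ge0.
  have h2 : (1 + s * k) ^+ 2 <= expR (s * k) ^+ 2.
    by rewrite lerXn2r ?nnegrE ?expR_ge0 ?addr_ge0 // expR_ge1Dx.
  apply: le_trans (_ : u * expR (s * k) ^+ 2 <= _); first by rewrite ler_wpM2l.
  by rewrite -expRM_natr /u -expRD (_ : - (2 * (s * k)) + s * k * 2 = 0) ?expR0 //; ring.
have y_ge : s * k * (1 - d) <= y by rewrite /y -mulrA ler_wpM2l.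
have y_le : y <= 2 * k by apply: le_trans rho2k; rewrite /y ler_piMl.
have N1 : 1 <= N by rewrite ler1n.
have := poisson_weight_arith u0 v1 k0' s0 s1 d0' d2 kd N0 dN N1 y_ge y_le.
have -> : expR (- (2 * c)) = k ^+ 2.
  by rewrite /k -expRM_natr; congr expR; ring.
have -> : expR (- (2 * s * k)) = u by rewrite /u mulrA.
have -> : u * (1 + 2 * s * k + s ^+ 2 * k ^+ 2) = u * (1 + s * k) ^+ 2 by ring.
rewrite -/pi; clear -lower corr; lra.
Qed.

(** * Passage to the limit *)

(** The exponential of (L + 1) / 2 is the fourth power of that of (L + 1) / 8, which
    exceeds (L + 1) / 8. *)
Lemma sqr_expR_small (R : realType) (eta L : R) : 0 < eta -> 1 <= L -> 2 * 8 ^+ 4 / eta <= L ->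
  (L + 1) ^+ 2 * expR (- (L / 2)) <= eta.
Proof.
move=> eta0 L1 Leta; set x := L + 1; have x1 : 1 <= x by rewrite /x; lra.
have x0 : 0 < x by lra.
have xsq : x <= x ^+ 2 by rewrite expr2 ler_peMl //; lra.
have E8 : x / 8 <= expR (x / 8) by have := expR_ge1Dx (x / 8); lra.
have E4 : (x / 8) ^+ 4 <= expR (x / 2).
  have -> : x / 2 = x / 8 * 4%:R by field.
  by rewrite expRM_natr lerXn2r ?nnegrE ?expR_ge0 // divr_ge0 // ltW.
have e2 : expR (1 / 2) <= 2 :> R by apply: (le_trans (expR_le_1D (d := 1) _ _ _)); lra.
have h : expR (- (L / 2)) * (x / 8) ^+ 4 <= 2.
  apply: le_trans e2; have -> : 1 / 2 = - (L / 2) + x / 2 by rewrite /x; field.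
  by rewrite expRD ler_wpM2l // expR_ge0.
have h2 : x ^+ 2 * expR (- (L / 2)) * x ^+ 2 <= 2 * 8 ^+ 4.
  rewrite (_ : x ^+ 2 * _ * _ = expR (- (L / 2)) * (x / 8) ^+ 4 * 8 ^+ 4); last by field.
  by rewrite ler_wpM2r // exprn_ge0.
rewrite -(ler_pM2r (_ : 0 < x ^+ 2)) ?exprn_gt0 //; apply: (le_trans h2).
by rewrite [leRHS]mulrC -ler_pdivrMr // (le_trans Leta) // (le_trans _ xsq) // lerDl.
Qed.

Local Open Scope classical_set_scope.

Lemma limn_einf_ge0 (R : realType) (u : nat -> R) :
  (forall e : R, 0 < e -> \forall n \near \oo, - e <= u n) ->
  (0 <= limn_einf (fun n => (u n)%:E))%E.
Proof.
move=> ue; apply/lee_addgt0Pr => e e0; have [m _ um] := ue e e0.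
rewrite -leeBlDr // add0e limn_einf_lim; apply: lime_ge; first exact: is_cvg_einfs.
exists m => // n /= mn; apply: le_ereal_inf_tmp => _ [k /= nk <-].
by rewrite lee_fin um //= (leq_trans mn).
Qed.

Theorem theorem4p7 (R : realType) (c : R) (p q eps : nat -> R)
  (heps : eps @ \oo --> (0 : R))
  (hp : forall n : nat, (0 < n)%N -> p n = (ln n%:R + c + eps n) / n%:R)
  (hq : forall n : nat, 0 <= q n <= 1) :
  (0 <= limn_einf (fun n : nat =>
    (digraph_prob (p n) (q n) (structurally_diagonalizable_digraphs R n)
     - expR (- (2 * (1 - q n) * expR (- c)))
       * (1 + 2 * (1 - q n) * expR (- c)
          + (1 - q n) ^+ 2 * expR (- (2 * c))))%:E))%E.
Proof.
apply: limn_einf_ge0 => e e0.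
set k := expR (- c); have k0 : 0 < k by rewrite expR_gt0.
set W := 8 * k + 4 + (1 + 2 * k) ^+ 2.
have W0 : 0 < W by rewrite /W; nra.
pose d := Num.min (1 / 2) (Num.min (1 / (8 * k)) (e / W)).
have d0 : 0 < d by rewrite /d !lt_min !divr_gt0 //; lra.
have d2 : d <= 1 / 2 by rewrite /d ge_min lexx.
have dk : 8 * k * d <= 1.
  by rewrite mulrC -ler_pdivlMr ?mulr_gt0 // /d !ge_min lexx !orbT.
have dW : d * W <= e by rewrite -ler_pdivlMr // /d !ge_min lexx !orbT.
have T0 : 0 < tolerance k.
  by rewrite /tolerance !addr_gt0 ?mulr_gt0 ?invr_gt0 ?expR_gt0.
pose eta := d / tolerance k.
have eta0 : 0 < eta by rewrite divr_gt0.
(* ln n >= bound forces L >= 1 + M, as |eps n| <= 1 *)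
pose M : R := 2 * 8 ^+ 4 / eta; pose bound := 1 + M + 1 - c.
near=> n.
have n0 : (0 < n)%N by near: n; exists 1%N.
have epsd : `|eps n| <= d / 4.
  near: n; have /cvgrPdist_le/(_ (d / 4)) := heps; rewrite divr_gt0 // => /(_ isT).
  by apply: filterS => n; rewrite sub0r normrN.
have nbound : expR bound <= n%:R by near: n; exact: nbhs_infty_ger.
have M0 : 0 < M by rewrite divr_gt0 // mulr_gt0 // exprn_gt0.
have Lbound : 1 + M <= ln n%:R + c + eps n.
  have : bound <= ln n%:R by rewrite -[leLHS]expRK ler_ln ?posrE ?expR_gt0 // ltr0n.
  by move: epsd; rewrite ler_norml /bound => /andP[h1 _]; lra.
rewrite (hp n n0).
apply: le_trans (digraph_prob_fixed_size (d := d) (eta := eta)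
  n0 (hq n) d0 d2 dk epsd _ _ _).
- by rewrite lerN2.
- by lra.
- by apply: sqr_expR_small; rewrite // -/M; lra.
- by rewrite /eta divfK // gt_eqF.
Unshelve. all: by end_near. Qed.
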